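(* Let $d\ge 1$, let $U\colon\mathbf{R}^d\to\mathbf{R}$ be twice continuously differentiable with $\int_{\mathbf{R}^d}\exp(-U(x))\,\mathrm{d}x<\infty$, and let $G\colon[0,\infty)\to[0,\infty)$ be continuous and nondecreasing. Suppose that $U$ is $G$-smooth. Let $\sigma>0$, fix $c>1$, and set $K=\mathcal{K}_{r,\sigma}(G)$ for $r=\sigma\,(c\,d)^{1/2}$. If $K<c^{1/2}$, then $$\underline{\alpha}_{\sigma}\ \ge\ \exp(-K)\,p_{d-1}(c)\,\left\{\Phi(c^{1/2})-\Phi(K)\right\}.$$
   Context: $\|\cdot\|$ is the Euclidean norm and $\|\cdot\|_{\mathrm{op}}$ the corresponding operator norm. $\Phi$ is the distribution function of the one-dimensional standard Gaussian. $a_+=\max\{a,0\}$. $G$-smoothness: $U$ is $G$-smooth if $\|\nabla^2U(x)\|_{\mathrm{op}}\le G(\|\nabla U(x)\|)$ for every $x\in\mathbf{R}^d$. Scalar flow: for $r,s\ge0$, $\Gamma(r,s)$ is the value at time $r$ of the maximal (i.e. pointwise largest) nonnegative solution of $\dot\gamma=G(\gamma)$, $\gamma(0)=s$. Convention: $\Gamma(r,s)=+\infty$ from the blow-up time on, if this solution blows up in finite time, and in that case $G(+\infty)=\lim_{u\to\infty}G(u)=+\infty$. Averaged curvature profile: $\overline{G}(r,s)=2\int_0^1(1-t)\,G(\Gamma(t\,r,s))\,\mathrm{d}t\in[0,\infty]$. For $r,\sigma>0$: $\mathcal{K}_{r,\sigma}(G)=\frac{r^2}{2}\,\sup\left\{\frac{\overline{G}(r,s)}{1+\sigma\,s}:s\ge0\right\}\in[0,\infty]$.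 For $k\ge1$, $p_k(c)=\mathbf{P}(\chi^2_k\le c\,k)$, where $\chi^2_k$ is a chi-square random variable with $k$ degrees of freedom; $p_0(c)=1$. Acceptance probabilities (Gaussian random-walk Metropolis with target density proportional to $\exp(-U)$): with $Z\sim\mathcal{N}(0,\mathbf{I}_d)$, $\alpha_\sigma(x)=\mathbf{E}\left(\exp\left(-[U(x+\sigma Z)-U(x)]_+\right)\right)$ and $\underline{\alpha}_\sigma=\inf_{x\in\mathbf{R}^d}\alpha_\sigma(x)$. *)

(* Defs.v *)
From HB Require Import structures.
From mathcomp Require Import all_boot all_order all_algebra.
From mathcomp Require Import all_classical all_reals all_analysis.

Set Implicit Arguments.
Unset Strict Implicit.
Unset Printing Implicit Defensive.

Import Order.TTheory GRing.Theory Num.Theory.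
Import numFieldNormedType.Exports.

Local Open Scope classical_set_scope.
Local Open Scope ring_scope.

(** * Product measures on [n.-tuple T] *)

Definition tcons {T : Type} n (x : T * n.-tuple T) : n.+1.-tuple T :=
  [the n.+1.-tuple T of x.1 :: x.2].

Section cons_measure.
Context d (T : measurableType d) (R : realType) (n : nat).
Variable mu : {sigma_finite_measure set T -> \bar R}.
Variable nu : {sigma_finite_measure set (n.-tuple T) -> \bar R}.

Lemma measurable_tcons : measurable_fun [set: T * n.-tuple T] (@tcons T n).
Proof. exact: measurable_cons. Qed.

Definition cons_measure : set (n.+1.-tuple T) -> \bar R :=
  pushforward (mu \x nu)%E (@tcons T n).

Let cons_measure0 : cons_measure set0 = 0%E.
Proof. by rewrite /cons_measure /pushforward preimage_set0 measure0. Qed.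

Let cons_measure_ge0 A : (0 <= cons_measure A)%E.
Proof. by rewrite /cons_measure /pushforward; exact: measure_ge0. Qed.

Let cons_measure_sigma_additive : semi_sigma_additive cons_measure.
Proof.
move=> F mF tF mUF; rewrite /cons_measure /pushforward preimage_bigcup.
have mpre A : measurable A -> measurable (@tcons T n @^-1` A).
  by move=> mA; rewrite -[X in measurable X]setTI; exact: measurable_tcons.
apply: measure_semi_sigma_additive.
- by move=> i; exact: mpre.
- apply/trivIsetP => /= i j _ _ ij; rewrite -preimage_setI.
  by move/trivIsetP : tF => /(_ _ _ _ _ ij) ->//; rewrite preimage_set0.
- by rewrite -preimage_bigcup; exact: mpre.
Qed.

HB.instance Definition _ := isMeasure.Build _ _ _ cons_measure
  cons_measure0 cons_measure_ge0 cons_measure_sigma_additive.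

Let cons_measure_sigma_finite : sigma_finite setT cons_measure.
Proof.
have /sigma_finiteP[F [TF ndF Foo]] := sigma_finiteT mu.
have /sigma_finiteP[G [TG ndG Goo]] := sigma_finiteT nu.
pose g (t : n.+1.-tuple T) : T * n.-tuple T := (thead t, [tuple of behead t]).
have mg : measurable_fun setT g.
  by apply/measurable_fun_pairP; split;
    [exact: measurable_tnth|exact: measurable_behead].
have gK x : g (tcons x) = x by case: x => a t; congr pair; exact: val_inj.
exists (fun i => g @^-1` (F i `*` G i)).
  rewrite predeqE => t; split=> // _.
  have [i _ Fi] : (\bigcup_i F i) (g t).1 by rewrite -TF.
  have [j _ Gj] : (\bigcup_i G i) (g t).2 by rewrite -TG.
  exists (maxn i j) => //; split.
    by move: Fi; exact/subsetPset/ndF/leq_maxl.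
  by move: Gj; exact/subsetPset/ndG/leq_maxr.
move=> i; have [? ?] := Foo i; have [? ?] := Goo i; split.
  by rewrite -[X in measurable X]setTI; apply: mg => //; exact: measurableX.
rewrite /cons_measure /pushforward -comp_preimage.
rewrite (_ : g \o _ = id) ?preimage_id; last exact/funext.
by rewrite product_measure1E// lte_mul_pinfty// ge0_fin_numE.
Qed.

HB.instance Definition _ := Measure_isSigmaFinite.Build _ _ _ cons_measure
  cons_measure_sigma_finite.

End cons_measure.

Fixpoint tuple_measure d (T : measurableType d) (R : realType)
    (mu : {sigma_finite_measure set T -> \bar R}) (n : nat) :
    {sigma_finite_measure set (n.-tuple T) -> \bar R} :=
  match n with
  | 0%N => \d_([tuple] : 0.-tuple T)
  | n'.+1 => cons_measure mu (tuple_measure mu n')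
  end.

Section euclidean.
Context {R : realType}.

Definition row_of_tuple n (t : n.-tuple R) : 'rV[R]_n := \row_i tnth t i.

(* [measurableTypeR R] is [R] with its Borel sigma-algebra. *)
Definition lebesgue_tuple (n : nat) :
    {sigma_finite_measure set (n.-tuple (measurableTypeR R)) -> \bar R} :=
  tuple_measure (@lebesgue_measure R) n.

Definition gaussian_tuple (n : nat) :
    {sigma_finite_measure set (n.-tuple (measurableTypeR R)) -> \bar R} :=
  tuple_measure (@normal_prob R 0 1) n.

(* The norm that the library puts on ['rV[R]_n] is the sup norm; it serves only
   for limits and derivatives, which do not depend on the choice of norm. *)
Definition enorm n (v : 'rV[R]_n) : R := Num.sqrt (\sum_i v ord0 i ^+ 2).

Definition opnorm n (A : 'M[R]_n) : R :=
  sup [set enorm (v *m A) | v in [set v | enorm v <= 1]].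

Definition gradient n (U : 'rV[R]_n -> R) (x : 'rV[R]_n) : 'rV[R]_n :=
  \row_i 'D_(delta_mx ord0 i) U x.

Definition hessian n (U : 'rV[R]_n -> R) (x : 'rV[R]_n) : 'M[R]_n :=
  'J (gradient U) x.

Definition twice_continuously_differentiable n (U : 'rV[R]_n -> R) : Prop :=
  [/\ forall x, differentiable U x,
      forall x, differentiable (gradient U) x
    & continuous (hessian U)].

Definition G_smooth n (G : R -> R) (U : 'rV[R]_n -> R) : Prop :=
  forall x, opnorm (hessian U x) <= G (enorm (gradient U x)).

End euclidean.

(** * The scalar flow of [G]; only the values of [G] on [0, +oo[ are used *)

Section flow.
Context {R : realType}.
Implicit Types (G g : R -> R) (s r sigma : R) (tau : \bar R).

(* [g] is a nonnegative solution of [g' = G(g)], [g(0) = s], on [0, tau[; the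
   derivative at 0 is the right derivative. *)
Definition nonneg_solution G s tau g : Prop :=
  [/\ g 0 = s,
      forall t : R, 0 <= t -> (t%:E < tau)%E -> 0 <= g t,
      h^-1 * (g h - g 0) @[h --> 0^'+] --> G (g 0)
    & forall t : R, 0 < t -> (t%:E < tau)%E -> is_derive t 1 g (G (g t))].

(* [gam] is the pointwise largest solution: it solves the equation on [0, tau[,
   where [tau] is [+oo] or the blow-up time, it equals [+oo] from [tau] on, and
   it dominates every solution on the interval where the latter is defined. *)
Definition maximal_solution G s (gam : R -> \bar R) : Prop :=
  (exists tau : \bar R,
    [/\ (0 < tau)%E,
        forall t : R, 0 <= t -> (t%:E < tau)%E -> gam t \is a fin_num,
        nonneg_solution G s tau (fine \o gam),
        forall T : R, tau = T%:E -> gam t @[t --> T^'-] --> +oo%E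
      & forall t : R, (tau <= t%:E)%E -> gam t = +oo%E]) /\
  (forall (T : \bar R) (g : R -> R), (0 < T)%E -> nonneg_solution G s T g ->
    forall t : R, 0 <= t -> (t%:E < T)%E -> ((g t)%:E <= gam t)%E).

(* [maximal_solution G s] determines its argument on [0, +oo[. *)
Definition flow G r s : \bar R := get (maximal_solution G s) r.

(* The flow reaches [+oo] only if [G] is unbounded, so that [+oo] is then the
   limit of [G] at infinity. *)
Definition extend G (u : \bar R) : \bar R :=
  if u is v%:E then (G v)%:E else +oo%E.

Definition averaged_profile G r s : \bar R :=
  (2%:E * \int[lebesgue_measure]_(t in `[0%R, 1%R])
            ((1 - t)%:E * extend G (flow G (t * r)%R s)))%E.

Definition curvature_constant r sigma G : \bar R :=
  ((r ^+ 2 / 2)%:E *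
    ereal_sup [set (averaged_profile G r s * (1 + sigma * s)^-1%:E)%E
              | s in [set s : R | (0 <= s)%R]])%E.

End flow.

Section probabilities.
Context {R : realType}.

Definition Phi (x : R) : \bar R := normal_prob 0 1 `]-oo, x].

(* The chi-square law with [k] degrees of freedom is the law of the sum of the
   squares of [k] independent standard Gaussian variables. *)
Definition chi2_cdf (k : nat) (x : R) : \bar R :=
  gaussian_tuple k [set z | \sum_(i < k) tnth z i ^+ 2 <= x].

Definition chi2_prob (k : nat) (c : R) : \bar R :=
  if k is 0%N then 1%E else chi2_cdf k (c * k%:R).

Definition acceptance n (U : 'rV[R]_n -> R) (sigma : R) (x : 'rV[R]_n) :
    \bar R :=
  \int[gaussian_tuple n]_z
    (expR (- Num.max (U (x + sigma *: row_of_tuple z) - U x) 0))%:E.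

Definition min_acceptance n (U : 'rV[R]_n -> R) (sigma : R) : \bar R :=
  ereal_inf (range (acceptance U sigma)).

End probabilities.

(* Main.v *)
Require Import Defs.
From HB Require Import structures.
From mathcomp Require Import all_boot all_order all_algebra.
From mathcomp Require Import all_classical all_reals all_analysis.
From mathcomp Require Import measurable_realfun normal_distribution ring lra.

(** Let [s] be the norm of the gradient of [U] at [x], [e] the unit vector
    opposite to this gradient and [r] the radius [sigma * sqrt (c * d)]. Along a
    segment of length at most [r] starting at [x], the norm of the gradient is a
    subsolution of the scalar equation, hence bounded by its maximal solution,
    and Taylor's formula gives
    [U (x + v) - U x <= <grad U x, v> + (|v| / r)^2 K (1 + sigma s)] for
    [|v| <= r]. For [v = sigma z] with [|z|^2 <= c d] the right-hand side is at
    most [K + sigma s (K - <e, z>)], which is at most [K] if [K < <e, z>]. So the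
    acceptance probability at [x] is at least [exp (- K)] times the probability
    that [K < <e, z> <= sqrt c] and [|z|^2 - <e, z>^2 <= c (d - 1)], which
    factorizes by the rotation invariance of the Gaussian law. *)

Import Order.TTheory GRing.Theory Num.Theory.
Import numFieldNormedType.Exports.

Local Open Scope classical_set_scope.
Local Open Scope ring_scope.

Set Implicit Arguments.
Unset Strict Implicit.
Unset Printing Implicit Defensive.

(** * Rotation invariance of the Gaussian law *)

(** The radius is the sum of two budgets: c for the squared coordinate along [e] and c (d - 1) for
    the remaining ones give |z|^2 <= c d. The delicate point is the scalar equation. Even if G
    vanishes at s, 1 / G may be integrable just above s, as for G(u) = sqrt u at s = 0. Solutions
    are then not unique, and only the largest one controls the norm of the gradient. Where G is
    positive above s, everything is read off an antiderivative F of 1 / G: if F stays bounded near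
    s, the flow is the inverse of F up to a constant; otherwise s cannot be left in finite time.
    Since [flow] is defined by choice, the solution constructed in this way still has to be compared
    with it. Finally, the norm of the gradient need not be differentiable where it vanishes, so
    differential inequalities are used only above the initial value s >= 0. *)

Section integration.
Local Open Scope ereal_scope.

Import HBNNSimple.

(** The integral of a nonnegative function is a supremum over the simple functions below it, so
    monotonicity holds for arbitrary functions. It is meant for the averaged profile and the
    acceptance integrand, whose measurability is then not at issue. *)
Lemma ge0_le_integral_nomeas d (T : measurableType d) (R : realType)
    (mu : {measure set T -> \bar R}) (D : set T) (f g : T -> \bar R) :
  (forall x, D x -> 0 <= f x) -> (forall x, D x -> f x <= g x) ->
  \int[mu]_(x in D) f x <= \int[mu]_(x in D) g x.
Proof.
move=> f0 fg; have g0 x : D x -> 0 <= g x.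
  by move=> Dx; exact: le_trans (f0 _ Dx) (fg _ Dx).
rewrite !ge0_integralE//; apply: le_ereal_sup => _ [h hf <-].
exists h => // x; apply: le_trans (hf x) _.
by rewrite !patchE; case: ifPn => // /[!inE]; exact: fg.
Qed.

(** By monotone convergence both sides pass to the limit along increasing simple functions; by
    linearity only indicators remain, where the claim is the hypothesis on [nu]. *)
Lemma ge0_integral_density d (T : measurableType d) (R : realType)
    (mu nu : {measure set T -> \bar R}) (p : T -> R) (f : T -> \bar R) :
  measurable_fun setT p -> (forall x, 0 <= p x)%R ->
  (forall A, measurable A -> nu A = \int[mu]_(x in A) (p x)%:E) ->
  measurable_fun setT f -> (forall x, 0 <= f x) ->
  \int[nu]_x f x = \int[mu]_x (f x * (p x)%:E).
Proof.
move=> mp p0 nuE mf f0.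
pose h := nnsfun_approx measurableT mf.
have hf x : limn (fun n => (h n x)%:E) = f x.
  by apply/cvg_lim => //; exact: cvg_nnsfun_approx.
have hnd x : {homo (fun n => (h n x)%:E) : m n / (m <= n)%N >-> m <= n}.
  by move=> m n mn; rewrite lee_fin; exact/lefP/nd_nnsfun_approx.
have mpE : measurable_fun setT (EFin \o p) by exact/measurable_EFinP.
transitivity (limn (fun n => \int[nu]_x (h n x)%:E)).
  rewrite -monotone_convergence//; last 2 first.
  - by move=> n; exact/measurable_EFinP.
  - by move=> n x _; rewrite lee_fin.
  by apply: eq_integral => x _; rewrite hf.
transitivity (limn (fun n => \int[mu]_x ((h n x)%:E * (p x)%:E))); last first.
  rewrite -monotone_convergence//; last 3 first.
  - by move=> n; apply: emeasurable_funM => //; exact/measurable_EFinP.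
  - by move=> n x _; rewrite mule_ge0 ?lee_fin.
  - by move=> x _ m n mn; apply: lee_wpmul2r; [rewrite lee_fin|exact: hnd].
  apply: eq_integral => x _; apply/cvg_lim => //.
  apply: cvgeZr => //; rewrite -hf; apply: ereal_nondecreasing_is_cvgn.
  exact: hnd.
congr (limn _); apply/funext => n.
under eq_integral do rewrite fimfunE -fsumEFin//.
rewrite ge0_integral_fsum//; last 2 first.
- by move=> y; exact/measurable_EFinP/measurable_funM.
- by move=> y x _; rewrite ?EFinM nnfun_muleindic_ge0.
under [RHS]eq_integral.
  move=> x _; rewrite fimfunE -fsumEFin// ge0_mule_fsuml; last first.
    by move=> y; rewrite ?EFinM nnfun_muleindic_ge0.
  over.
rewrite ge0_integral_fsum//; last 2 first.
- move=> y; apply: emeasurable_funM => //.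
  exact/measurable_EFinP/measurable_funM.
- by move=> y x _; apply: mule_ge0; rewrite ?lee_fin// -lee_fin EFinM nnfun_muleindic_ge0.
apply: eq_fsbigr => r; rewrite inE => -[z _ zr].
have r0 : (0 <= r)%R by rewrite -zr.
rewrite (eq_integral (fun x => r%:E * (\1_(h n @^-1` [set r]) x)%:E)); last first.
  by move=> x _; rewrite EFinM.
rewrite ge0_integralZl//; last exact/measurable_EFinP.
rewrite integral_indic// setIT nuE//.
rewrite [in LHS]integral_mkcond.
rewrite -ge0_integralZl//; last 2 first.
- exact/(measurable_restrictT _ _).1/measurable_funTS.
- by move=> x _; apply: erestrict_ge0 => y _; rewrite lee_fin.
apply: eq_integral => x _; rewrite patchE indicE.
by case: ifPn => _; rewrite ?mulr1 ?mulr0// mule0 mul0e.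
Qed.

End integration.

Section gaussian_rotation.
Local Open Scope ereal_scope.
Context (R : realType).
Local Notation M := (measurableTypeR R).
Local Notation leb := (@lebesgue_measure R).
Local Notation N01 := (@normal_prob R 0 1).

Lemma lebesgue_measureD (a : R) (A : set M) : measurable A ->
  pushforward leb (fun x : M => (x + a)%R : M) A = leb A.
Proof.
move=> mA; apply/esym.
have ma : measurable_fun [set: M] (fun x : M => (x + a)%R : M).
  exact: measurable_funD.
pose mu' : {measure set M -> \bar R} :=
  measure_function_pushforward__canonical__measure_function_Measure leb ma.
apply: (lebesgue_measure_unique (mu := mu')) => //= _ [[u v]] _ <-.
rewrite /pushforward.
rewrite (_ : _ @^-1` _ = `](u - a)%R, (v - a)%R]%classic).
  rewrite !lebesgue_measure_itv/= !lte_fin ltrD2r; case: ifP => // _.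
  by rewrite -!EFinB; congr (_%:E); ring.
by apply/seteqP; split=> x /=; rewrite !in_itv/= ltrBlDr lerBrDr.
Qed.

Lemma ge0_integral_lebesgueD (a : R) (f : M -> \bar R) :
  measurable_fun setT f -> (forall x, 0 <= f x) ->
  \int[leb]_x f (x + a)%R = \int[leb]_x f x.
Proof.
move=> mf f0.
have ma : measurable_fun [set: M] (fun x : M => (x + a)%R : M).
  exact: measurable_funD.
rewrite -[LHS](ge0_integral_pushforward ma leb measurableT)//=.
by apply: eq_measure_integral => A mA _; exact: lebesgue_measureD.
Qed.

Lemma integral_shear2 (t : R) (f : M * M -> \bar R) :
  measurable_fun setT f -> (forall z, 0 <= f z) ->
  \int[leb]_x \int[leb]_y f (x, y + t * x)%R = \int[leb]_x \int[leb]_y f (x, y).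
Proof.
move=> mf f0; apply: eq_integral => x _.
apply: (ge0_integral_lebesgueD (t * x) (f := fun y => f (x, y))) => //.
exact: measurableT_comp.
Qed.

Lemma integral_shear1 (t : R) (f : M * M -> \bar R) :
  measurable_fun setT f -> (forall z, 0 <= f z) ->
  \int[leb]_x \int[leb]_y f (x + t * y, y)%R = \int[leb]_x \int[leb]_y f (x, y).
Proof.
move=> mf f0.
have mS : measurable_fun setT (fun z : M * M => (z.1 + t * z.2, z.2)%R : M * M).
  apply/measurable_fun_pairP; split; last exact: measurable_snd.
  by apply: measurable_funD => //; exact: measurable_funM.
apply: (etrans (fubini_tonelli (m1 := leb) (m2 := leb)
  (fun z => f (z.1 + t * z.2, z.2)%R) (measurableT_comp mf mS) (fun z => f0 _))).
apply: (etrans _ (esym (fubini_tonelli (m1 := leb) (m2 := leb) f mf f0))).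
apply: eq_integral => y _.
apply: (ge0_integral_lebesgueD (t * y) (f := fun x => f (x, y))) => //.
exact: measurableT_comp.
Qed.

Definition rot (a b : R) (z : M * M) : M * M :=
  (a * z.1 + b * z.2, - b * z.1 + a * z.2)%R.

Lemma measurable_rot a b : measurable_fun setT (rot a b).
Proof.
by apply/measurable_fun_pairP; split => /=;
  apply: measurable_funD => //; exact: measurable_funM.
Qed.

(* A rotation is a product of three shears, each of which preserves the
   Lebesgue measure by Fubini and translation invariance. *)
Lemma integral_rot_lebesgue (a b : R) (f : M * M -> \bar R) :
  (0 <= a)%R -> (a ^+ 2 + b ^+ 2 = 1)%R ->
  measurable_fun setT f -> (forall z, 0 <= f z) ->
  \int[leb]_x \int[leb]_y f (rot a b (x, y)) = \int[leb]_x \int[leb]_y f (x, y).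
Proof.
move=> a0 ab1 mf f0.
have a1 : (1 + a != 0)%R by rewrite gt_eqF// ltr_wpDr.
(* For a = cos theta and b = sin theta this is tan (theta / 2), the coefficient of the two outer
   shears; [0 <= a] excludes the half-turn, where it is infinite. *)
pose t := (b / (1 + a))%R.
have tab : (t * (1 + a) = b)%R by rewrite /t divfK.
have tb : (t * b = 1 - a)%R.
  have b2 : (b ^+ 2 = 1 - a ^+ 2)%R by rewrite -ab1; ring.
  by apply: (mulIf a1); rewrite mulrAC tab -expr2 b2; ring.
pose S1 (z : M * M) : M * M := (z.1 + t * z.2, z.2)%R.
pose S2 (z : M * M) : M * M := (z.1, z.2 + - b * z.1)%R.
have mS1 : measurable_fun setT S1.
  apply/measurable_fun_pairP; split; last exact: measurable_snd.
  by apply: measurable_funD => //; exact: measurable_funM.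
have mS2 : measurable_fun setT S2.
  apply/measurable_fun_pairP; split; first exact: measurable_fst.
  by apply: measurable_funD => //; exact: measurable_funM.
have rotE z : rot a b z = S1 (S2 (S1 z)).
  rewrite /rot /S1 /S2 /=; congr pair.
    transitivity ((1 - t * b) * z.1 + (t * (1 + a) + t * (1 - a - t * b)) * z.2)%R.
      by rewrite tb tab; ring.
    by ring.
  transitivity (- b * z.1 + (1 - t * b) * z.2)%R; last by ring.
  by rewrite tb; ring.
under eq_integral do under eq_integral do rewrite rotE.
have mf1 := measurableT_comp mf mS1.
apply: (etrans (integral_shear1 t (f := fun z => f (S1 (S2 z)))
  (measurableT_comp mf1 mS2) (fun z => f0 _))).
apply: (etrans (integral_shear2 (- b) (f := fun z => f (S1 z)) mf1 (fun z => f0 _))).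
exact: integral_shear1.
Qed.

Local Notation pdf := (normal_pdf 0 1 : R -> R).

Lemma ge0_integral_normal (f : M -> \bar R) :
  measurable_fun setT f -> (forall x, 0 <= f x) ->
  \int[N01]_x f x = \int[leb]_x (f x * (pdf x)%:E).
Proof.
move=> mf f0; apply: ge0_integral_density => //.
  exact: measurable_normal_pdf.
by move=> x; exact: normal_pdf_ge0.
Qed.

Lemma ge0_integral_normal2 (f : M * M -> \bar R) :
  measurable_fun setT f -> (forall z, 0 <= f z) ->
  \int[N01]_x \int[N01]_y f (x, y) =
  \int[leb]_x \int[leb]_y (f (x, y) * (pdf x * pdf y)%:E).
Proof.
move=> mf f0.
have mpdf := measurable_normal_pdf (0 : R) 1.
rewrite ge0_integral_normal; last 2 first.
- exact: (measurable_fun_fubini_tonelli_F f).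
- by move=> x; exact: integral_ge0.
apply: eq_integral => x _.
rewrite ge0_integral_normal//; last exact: measurableT_comp.
rewrite -ge0_integralZr//; last 3 first.
- apply: emeasurable_funM; first exact: measurableT_comp.
  exact/measurable_EFinP.
- by move=> y _; rewrite mule_ge0// lee_fin normal_pdf_ge0.
- by rewrite lee_fin normal_pdf_ge0.
by apply: eq_integral => y _; rewrite -muleA EFinM [X in _ * X]muleC.
Qed.

(** The product of the two densities depends on x^2 + y^2 only. *)
Lemma pdfM_rot (a b x y : R) : (a ^+ 2 + b ^+ 2 = 1)%R ->
  (pdf (rot a b (x, y)).1 * pdf (rot a b (x, y)).2 = pdf x * pdf y)%R.
Proof.
move=> ab1; rewrite !normal_pdfE ?oner_neq0//= /normal_fun.
rewrite [LHS]mulrACA [RHS]mulrACA -!expRD; congr (_ * expR _)%R.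
rewrite -!mulrDl; congr (_ / _)%R; rewrite !subr0.
transitivity (- ((a ^+ 2 + b ^+ 2) * (x ^+ 2 + y ^+ 2)))%R; first by ring.
by rewrite ab1; ring.
Qed.

Lemma integral_rot_normal (a b : R) (f : M * M -> \bar R) :
  (0 <= a)%R -> (a ^+ 2 + b ^+ 2 = 1)%R ->
  measurable_fun setT f -> (forall z, 0 <= f z) ->
  \int[N01]_x \int[N01]_y f (rot a b (x, y)) =
  \int[N01]_x \int[N01]_y f (x, y).
Proof.
move=> a0 ab1 mf f0.
have mpdf := measurable_normal_pdf (0 : R) 1.
rewrite (@ge0_integral_normal2 (fun z => f (rot a b z))
  (measurableT_comp mf (measurable_rot a b)) (fun z => f0 _)).
rewrite (ge0_integral_normal2 mf f0).
rewrite -[RHS](integral_rot_lebesgue a0 ab1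
  (f := fun z => f z * (pdf z.1 * pdf z.2)%:E)); last 2 first.
- apply: emeasurable_funM => //; apply/measurable_EFinP.
  by apply: measurable_funM; exact: measurableT_comp.
- by move=> z; rewrite mule_ge0// lee_fin mulr_ge0// normal_pdf_ge0.
apply: eq_integral => x _; apply: eq_integral => y _.
exact: (congr1 (fun r => f (rot a b (x, y)) * r%:E) (esym (pdfM_rot x y ab1))).
Qed.

(** The quarter turn maps (x, y) to (y, - x); its invariance is applied to a function of the second
    coordinate alone. *)
Lemma integral_oppr_normal (f : M -> \bar R) :
  measurable_fun setT f -> (forall x, 0 <= f x) ->
  \int[N01]_x f (- x)%R = \int[N01]_x f x.
Proof.
move=> mf f0.
have e1 : (0 ^+ 2 + 1 ^+ 2 = 1 :> R)%R by rewrite expr0n expr1n add0r.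
have := integral_rot_normal (lexx 0%R) e1
  (measurableT_comp mf (@measurable_snd _ _ M M)) (fun z => f0 z.2).
rewrite /rot /=.
under eq_integral do under eq_integral do rewrite mul0r addr0 mulN1r.
have cstE (k : \bar R) : \int[N01]_x k = k.
  by rewrite (integral_cst N01 measurableT) [X in _ * X]probability_setT mule1.
under eq_integral do rewrite cstE.
by move=> ->; rewrite cstE.
Qed.

Local Notation tup n := (n.-tuple M).

Definition sqsum n (z : tup n) : M := (\sum_(i < n) tnth z i ^+ 2)%R.

Definition dotp n (e : 'I_n -> R) (z : tup n) : M :=
  (\sum_(i < n) e i * tnth z i)%R.

Lemma measurable_sqsum n : measurable_fun setT (@sqsum n).
Proof.
by apply: measurable_sum => i; apply: measurable_funX; exact: measurable_tnth.
Qed.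

Lemma measurable_dotp n (e : 'I_n -> R) : measurable_fun setT (dotp e).
Proof.
by apply: measurable_sum => i; apply: measurable_funM => //; exact: measurable_tnth.
Qed.

Lemma sqsum_tcons n x (z : tup n) : sqsum (tcons (x, z)) = (x ^+ 2 + sqsum z)%R.
Proof.
rewrite /sqsum big_ord_recl tnth0; congr (_ + _)%R.
by apply: eq_bigr => i _; rewrite tnthS.
Qed.

Lemma dotp_tcons n (e : 'I_n.+1 -> R) x (z : tup n) :
  dotp e (tcons (x, z)) = (e ord0 * x + dotp (e \o lift ord0) z)%R.
Proof.
rewrite /dotp big_ord_recl tnth0; congr (_ + _)%R.
by apply: eq_bigr => i _; rewrite tnthS.
Qed.

Lemma ge0_integral_gaussian_tupleS n (f : tup n.+1 -> \bar R) :
  measurable_fun setT f -> (forall z, 0 <= f z) ->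
  \int[@gaussian_tuple R n.+1]_z f z =
  \int[N01]_x \int[@gaussian_tuple R n]_z f (tcons (x, z)).
Proof.
move=> mf f0.
have mt := @measurable_tcons _ M n.
rewrite [LHS](ge0_integral_pushforward mt _ measurableT)//=.
rewrite (fubini_tonelli1 (m1 := N01) (m2 := @gaussian_tuple R n))//.
exact: measurableT_comp mf mt.
Qed.

(** If [v] vanishes, any unit vector will do; the dimension is positive, so the first basis vector
    is available. *)
Lemma unit_direction n (v : 'I_n.+1 -> R) :
  exists2 u : 'I_n.+1 -> R, (\sum_i u i ^+ 2 = 1)%R &
    forall i, v i = (Num.sqrt (\sum_i v i ^+ 2) * u i)%R.
Proof.
set r := Num.sqrt _; have v2 : (0 <= \sum_i v i ^+ 2)%R.
  by apply: sumr_ge0 => i _; exact: sqr_ge0.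
have [r0|r0] := eqVneq r 0%R; last first.
  exists (fun i => v i / r)%R; last by move=> i; rewrite mulrCA divff// mulr1.
  under eq_bigr do rewrite exprMn exprVn.
  rewrite -mulr_suml -(sqr_sqrtr v2) -/r divff//.
  by rewrite expf_neq0.
exists (fun i => (i == ord0)%:R); last first.
  move: (r0) => /eqP; rewrite sqrtr_eq0 => v2le i; rewrite r0 mul0r.
  have /eqP : (\sum_i v i ^+ 2 = 0)%R by apply/eqP; rewrite eq_le v2le.
  rewrite psumr_eq0; last by move=> j _; exact: sqr_ge0.
  by move=> /allP/(_ i); rewrite mem_index_enum sqrf_eq0 => /(_ isT)/eqP.
rewrite (bigD1 ord0)//= big1 ?addr0 ?expr1n//.
by move=> i /negPf ->; rewrite expr0n.
Qed.

(* The pair (<e, z>, |z|^2 - <e, z>^2) has the law of (w, |z'|^2), with w and z'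
   independent standard Gaussians in dimensions 1 and n. Writing e as
   (e_0, rho u) with u a unit vector, the induction hypothesis for u leaves a
   rotation of the plane spanned by the first axis and u. *)
Lemma integral_rotation n (e : 'I_n.+1 -> R) (f : M * M -> \bar R) :
  (\sum_i e i ^+ 2 = 1)%R ->
  measurable_fun setT f -> (forall z, 0 <= f z) ->
  \int[@gaussian_tuple R n.+1]_z f (dotp e z, sqsum z - dotp e z ^+ 2)%R =
  \int[N01]_w \int[@gaussian_tuple R n]_z f (w, sqsum z).
Proof.
have mg m (e' : 'I_m -> R) : measurable_fun setT (fun z : tup m =>
    (dotp e' z, sqsum z - dotp e' z ^+ 2)%R : M * M).
  apply/measurable_fun_pairP; split; first exact: measurable_dotp.
  apply: measurable_funB; first exact: measurable_sqsum.
  by apply: measurable_funX; exact: measurable_dotp.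
elim: n => [|n IH] in e f *; move=> e1 mf f0.
  apply: (etrans (ge0_integral_gaussian_tupleS
    (measurableT_comp mf (mg _ e)) (fun z => f0 _))).
  (* In dimension 1 the vector [e] is 1 or -1 and |z|^2 - <e, z>^2 vanishes, so the symmetry of the
     law suffices. *)
  have e2 : (e ord0 ^+ 2 = 1)%R by rewrite -e1 big_ord1.
  have fE x z : f (dotp e (tcons (x, z)),
      sqsum (tcons (x, z)) - dotp e (tcons (x, z)) ^+ 2)%R = f (e ord0 * x, 0)%R.
    rewrite dotp_tcons sqsum_tcons /dotp /sqsum !big_ord0 !addr0.
    by rewrite exprMn e2 mul1r subrr.
  have cstE (k : \bar R) : \int[@gaussian_tuple R 0]_z k = k.
    by rewrite (integral_cst _ measurableT) [X in _ * X](_ : _ = 1) ?mule1//; exact: diracT.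
  transitivity (\int[N01]_x f (e ord0 * x, 0)%R).
    by apply: eq_integral => x _; rewrite -[RHS]cstE; apply: eq_integral => z _; exact: fE.
  transitivity (\int[N01]_x f (x, 0)%R); last first.
    apply: eq_integral => x _; rewrite -[LHS]cstE; apply: eq_integral => z _.
    by rewrite /sqsum big_ord0.
  have m0 : measurable_fun setT (fun x : M => f (x, 0%R)).
    exact: measurableT_comp.
  move/eqP : e2; rewrite sqrf_eq1 => /orP[] /eqP ->.
    by under eq_integral do rewrite mul1r.
  under eq_integral do rewrite mulN1r.
  exact: (integral_oppr_normal m0).
have [u u1 eu] := unit_direction (e \o lift ord0).
set r := Num.sqrt _ in eu.
have r0 : (0 <= r)%R by exact: sqrtr_ge0.
have re1 : (r ^+ 2 + (e ord0) ^+ 2 = 1)%R.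
  rewrite sqr_sqrtr; last by apply: sumr_ge0 => i _; exact: sqr_ge0.
  by rewrite addrC -e1 [RHS]big_ord_recl.
have dE z : dotp (e \o lift ord0) z = (r * dotp u z)%R.
  by rewrite /dotp mulr_sumr; apply: eq_bigr => i _; rewrite eu mulrA.
(* The integrand in terms of the first coordinate x and, for the other coordinates z, of w = <u, z>
   and |z|^2 - w^2. It rests on x^2 + w^2 - (e_0 x + r w)^2 = (r x - e_0 w)^2, valid because r^2 +
   e_0^2 = 1. *)
pose g x (z : M * M) := f (e ord0 * x + r * z.1, (r * x - e ord0 * z.1) ^+ 2 + z.2)%R.
have mg2 : measurable_fun setT (fun q : M * (M * M) =>
    (e ord0 * q.1 + r * q.2.1, (r * q.1 - e ord0 * q.2.1) ^+ 2 + q.2.2)%R : M * M).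
  have m1 : measurable_fun setT (fun q : M * (M * M) => q.2.1 : M).
    exact: (measurableT_comp measurable_fst measurable_snd).
  have m2 : measurable_fun setT (fun q : M * (M * M) => q.2.2 : M).
    exact: (measurableT_comp measurable_snd measurable_snd).
  apply/measurable_fun_pairP; split => /=.
    by apply: measurable_funD; apply: measurable_funM.
  apply: measurable_funD => //; apply: measurable_funX.
  by apply: measurable_funB; apply: measurable_funM.
have mgx x : measurable_fun setT (g x).
  apply: (measurableT_comp (measurableT_comp mf mg2) (g := fun z => (x, z))).
  exact: measurable_pair1.
apply: (etrans (ge0_integral_gaussian_tupleS
  (measurableT_comp mf (mg _ e)) (fun z => f0 _))).
transitivity (\int[N01]_x \int[N01]_w \int[@gaussian_tuple R n]_z g x (w, sqsum z)).
  apply: eq_integral => x _; rewrite -(IH u)//; last by move=> z; exact: f0.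
  apply: eq_integral => z _.
  transitivity (f (dotp e (tcons (x, z)),
    sqsum (tcons (x, z)) - dotp e (tcons (x, z)) ^+ 2)%R); first by [].
  rewrite /g dotp_tcons sqsum_tcons dE /=.
  congr (f (_, _)).
  transitivity (x ^+ 2 * (1 - e ord0 ^+ 2) + sqsum z - (r * dotp u z) ^+ 2
     - 2 * e ord0 * x * r * dotp u z)%R; first by ring.
  rewrite -re1.
  transitivity (r ^+ 2 * x ^+ 2 + sqsum z - dotp u z ^+ 2 * (1 - e ord0 ^+ 2)
     - 2 * e ord0 * x * r * dotp u z)%R; first by rewrite -re1; ring.
  by ring.
pose h (z : M * M) := \int[@gaussian_tuple R n]_y f (z.1, z.2 ^+ 2 + sqsum y)%R.
have mh0 : measurable_fun setT (fun q : (M * M) * tup n => f (q.1.1, q.1.2 ^+ 2 + sqsum q.2)%R).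
  apply: (measurableT_comp mf); apply/measurable_fun_pairP; split => /=.
    exact: (measurableT_comp measurable_fst measurable_fst).
  apply: measurable_funD.
    apply: measurable_funX.
    exact: (measurableT_comp measurable_snd measurable_fst).
  exact: (measurableT_comp (@measurable_sqsum n) measurable_snd).
have mh : measurable_fun setT h.
  have := measurable_fun_fubini_tonelli_F (m2 := @gaussian_tuple R n) _ mh0 (fun=> f0 _).
  rewrite /fubini_F => H. exact H.
have h0 z : 0 <= h z by exact: integral_ge0.
(* The plane is taken in the order (w, x) so that the cosine is r >= 0, as the rotation lemma
   requires; the sign of [e ord0] is unknown. *)
transitivity (\int[N01]_w \int[N01]_x h (rot r (e ord0) (w, x))).
  have mhr := measurableT_comp mh (measurable_rot r (e ord0)).
  have mhs : measurable_fun setT (fun z : M * M => h (rot r (e ord0) (z.2, z.1))).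
    apply: (measurableT_comp mhr (g := fun z : M * M => (z.2, z.1))).
    exact: measurable_swap.
  transitivity (\int[N01]_x \int[N01]_w h (rot r (e ord0) (w, x))); last first.
    exact: (fubini_tonelli (m1 := N01) (m2 := N01) _ mhs (fun z => h0 _)).
  apply: eq_integral => x _; apply: eq_integral => w _.
  rewrite /h; apply: eq_integral => y _; rewrite /g /rot /=.
  by congr (f (_, _ + _)%R); ring.
apply: (etrans (integral_rot_normal r0 re1 mh h0)); apply: eq_integral => w _.
have mfw : measurable_fun setT (fun z : tup n.+1 => f (w, sqsum z)).
  apply: (measurableT_comp mf (g := fun z => (w, sqsum z))).
  apply: (measurableT_comp (measurable_pair1 w)); exact: measurable_sqsum.
rewrite (ge0_integral_gaussian_tupleS mfw (fun z => f0 _)).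
apply: eq_integral => x _; apply: eq_integral => y _.
by rewrite /= sqsum_tcons.
Qed.

End gaussian_rotation.

(** * Comparison for scalar differential inequalities *)

Section calculus.
Context {R : realType}.
Implicit Types (f F H y : R -> R).

Lemma is_derive_continuous f (x l : R) : is_derive x 1 f l -> {for x, continuous f}.
Proof.
by move=> [df _]; apply: differentiable_continuous; exact/derivable1_diffP.
Qed.

Lemma is_derive_within_continuous f f' (a b : R) :
  (forall x, a <= x <= b -> is_derive x 1 f (f' x)) ->
  {within `[a, b], continuous f}.
Proof.
move=> df; apply: derivable_within_continuous => x.
by rewrite in_itv/= => /df[].
Qed.

Lemma is_derive_eqB f g h (a u v : R) :
  (forall x, a < x -> is_derive x 1 f (h x)) ->
  (forall x, a < x -> is_derive x 1 g (h x)) ->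
  a < u -> u <= v -> f v - f u = g v - g u.
Proof.
move=> df dg au uv.
have dfg x : a < x -> is_derive x 1 (fun t => f t - g t) 0.
  move=> ax; rewrite -(subrr (h x)).
  by have := df _ ax; have := dg _ ax => ? ?; exact: is_deriveB.
have [||c _] := @MVT_segment R (fun t => f t - g t) (fun=> 0) u v uv.
- by move=> x /itvP xuv; apply: dfg; rewrite (lt_trans au)// xuv.
- apply: (is_derive_within_continuous (f' := fun=> 0)) => x /andP[ux _].
  by apply: dfg; exact: lt_le_trans ux.
by rewrite mul0r; lra.
Qed.

(** As [f] may fail to be integrable near [a], no integral can start there. The base point [bot u]
    varies with u instead, and normalizing at a + 1 makes the value independent of it ([FE]). *)
Lemma antiderivative_gt f (a : R) : (forall u, a < u -> {for u, continuous f}) ->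
  exists F, forall u, a < u -> is_derive u 1 F (f u).
Proof.
move=> cf; pose mu := @lebesgue_measure R.
pose M b u := (\int[mu]_(t in `[b, u]) f t).
have dM b u : a < b -> b < u -> is_derive u 1 (M b) (f u).
  move=> ab bu; have [||||d1 d2] := @continuous_FTC1_closed R f b u (u + 1).
  - by rewrite ltrDl.
  - apply: continuous_compact_integrable; first exact: segment_compact.
    apply: continuous_in_subspaceT => x /[!inE]/= /itvP bx.
    by apply: cf; rewrite (lt_le_trans ab)// bx.
  - exact: bu.
  - by apply: cf; exact: lt_trans bu.
  apply: DeriveDef; first exact: d1.
  by rewrite -derive1E; exact: d2.
pose bot u := (a + Num.min u (a + 1)) / 2.
have botP u : a < u -> a < bot u /\ bot u < Num.min u (a + 1).
  move=> au; have : a < Num.min u (a + 1) by rewrite lt_min au ltrDl ltr01.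
  by move/midf_lt => [].
pose F u := M (bot u) u - M (bot u) (a + 1).
have FE b u : a < b -> b < Num.min u (a + 1) -> F u = M b u - M b (a + 1).
  move=> ab bu; have au : a < u.
    by apply: (lt_trans ab); move: bu; rewrite lt_min => /andP[].
  have [b1 b2] := botP _ au; rewrite /F.
  set c := Num.max b (bot u).
  have cm : c < Num.min u (a + 1) by rewrite gt_max bu.
  have d1 x : c < x -> is_derive x 1 (M b) (f x).
    by rewrite gt_max => /andP[? ?]; exact: dM.
  have d2 x : c < x -> is_derive x 1 (M (bot u)) (f x).
    by rewrite gt_max => /andP[? ?]; exact: dM.
  move: cm; rewrite lt_min => /andP[cu ca1].
  have [ua1|/ltW ua1] := leP u (a + 1).
    by have := is_derive_eqB d2 d1 cu ua1; lra.
  by have := is_derive_eqB d2 d1 ca1 ua1; lra.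
exists F => u au; have [b1 b2] := botP _ au.
apply: (@near_eq_is_derive _ _ _ (fun x => M (bot u) x - M (bot u) (a + 1))).
  move: b2; rewrite lt_min => /andP[b2 b3].
  have : \forall x \near u, bot u < x by exact: lt_nbhsr.
  apply: filterS => x bx; rewrite -FE//.
  by rewrite lt_min bx.
move: b2; rewrite lt_min => /andP[b2 b3].
rewrite -(subr0 (f u)); have := dM _ _ b1 b2 => ?; exact: is_deriveB.
Qed.

(** The time t is the supremum of those at which y <= u. From t on, an inequality known only above a
    given level becomes usable without interruption. *)
Lemma last_crossing y (T u : R) : 0 <= T -> {within `[0, T], continuous y} ->
  y 0 <= u -> u < y T ->
  exists t, [/\ 0 <= t < T, y t = u & forall x, t < x <= T -> u < y x].
Proof.
move=> T0 cy y0 yT.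
have T1 : 0 < T.
  by rewrite lt_neqAle T0 andbT; apply/eqP => e; move: yT; rewrite -e ltNge y0.
pose E := [set t | 0 <= t <= T /\ y t <= u].
have E0 : E 0 by split => //; rewrite lexx ltW.
have ubE : ubound E T by move=> x [/andP[]].
have supE : has_sup E by split; [exists 0|exists T].
have supT : sup E <= T by apply: ge_sup => //; exists 0.
have sup0 : 0 <= sup E by apply: (sup_upper_bound supE).
have gt_sup x : sup E < x <= T -> u < y x.
  move=> /andP[Ex xT]; rewrite ltNge; apply/negP => yx.
  have : E x by split=> //; rewrite xT (le_trans sup0)// ltW.
  by move/(sup_upper_bound supE); rewrite leNgt Ex.
have ysup : y (sup E) <= u.
  rewrite leNgt; apply/negP => uy.
  have supgt0 : 0 < sup E.
    by rewrite lt_neqAle sup0 andbT; apply/eqP => e; move: uy; rewrite -e ltNge y0.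
  have : y x @[x --> (sup E)^'-] --> y (sup E).
    have /(continuous_within_itvP _ T1)[c1 _ c3] := cy.
    move: supT; rewrite le_eqVlt => /predU1P[->//|sT].
    by apply: cvg_at_left_filter; apply: c1; rewrite in_itv/= supgt0.
  move/cvgr_gt => /(_ _ uy) near1.
  have [e /= e0 he] := near1.
  have [x Ex xe] := sup_adherent e0 supE.
  have xs := sup_upper_bound supE Ex.
  case: Ex => _; apply/negP; rewrite -ltNge.
  move: xs; rewrite le_eqVlt => /predU1P[->//|xs].
  by apply: he => //=; rewrite ger0_norm; lra.
have sT : sup E < T.
  rewrite lt_neqAle supT andbT; apply/eqP => e.
  by move: yT; rewrite -e ltNge ysup.
exists (sup E); rewrite sup0 sT; split => //.
have [||c /itvP cs yc] := @IVT R y (sup E) T u supT.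
- by apply: continuous_subspaceW cy; apply: subset_itvr; rewrite bnd_simp.
- by rewrite ge_min ysup/= le_max (ltW yT) orbT.
have : sup E <= c by rewrite cs.
rewrite le_eqVlt => /predU1P[->//|sc].
have : u < y c by apply: gt_sup; rewrite sc cs.
by rewrite yc ltxx.
Qed.

(** The inequality is required only above s. For the norm of a gradient, with s >= 0, this avoids
    the zeros of the gradient. The factor [rho] is the speed at which a segment is travelled. *)
Definition subsolution (G : R -> R) (s rho T : R) y : Prop :=
  [/\ 0 <= rho, 0 <= T, {within `[0, T], continuous y}, y 0 <= s &
    forall t, 0 < t < T -> s < y t ->
      exists2 dy, is_derive t 1 y dy & dy <= rho * G (y t)].

(** F measures travel time at unit speed: after the last crossing of u, the derivative of F o y is
    y' / H(y) <= rho. *)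
Lemma subsolution_travel_time (H F y : R -> R) (s rho T u : R) :
  (forall v, s < v -> 0 < H v) ->
  (forall v, s < v -> is_derive v 1 F (H v)^-1) ->
  subsolution H s rho T y -> s < u -> u < y T -> F (y T) - F u <= rho * T.
Proof.
move=> H0 dF [rho0 T0 cy y0 dy] su uy.
have [t [/andP[t0 tT] yt yu]] := last_crossing T0 cy (le_trans y0 (ltW su)) uy.
have cF v : s < v -> {for v, continuous F}.
  by move=> /dF /is_derive_continuous.
have dFy x : x \in `]t, T[ -> exists2 l, is_derive x 1 (F \o y) l & l <= rho.
  rewrite in_itv/= => /andP[tx xT].
  have yx : s < y x by rewrite (lt_trans su)// yu// tx ltW.
  have [|l dl lle] := dy x _ yx; first by rewrite xT (le_lt_trans t0).
  exists ((H (y x))^-1 * l); first by apply: is_derive1_comp => //; exact: dF.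
  by rewrite mulrC ler_pdivrMr ?H0.
have [||c ctT] := @MVT R (F \o y) (F \o y)^`()%classic t T tT.
- by move=> x /dFy[l dl _]; rewrite derive1E derive_val.
- have T0' : 0 < T by exact: le_lt_trans tT.
  have /(continuous_within_itvP _ T0')[c1 c2 c3] := cy.
  apply/(continuous_within_itvP _ tT); split.
  + move=> x /[!in_itv]/= /andP[tx xT]; apply: continuous_comp.
      by apply: c1; rewrite in_itv/= xT (le_lt_trans t0).
    by apply: cF; rewrite (lt_trans su)// yu// tx ltW.
  + apply: (cvg_comp y F); last by apply: cF; rewrite yt.
    move: t0; rewrite le_eqVlt => /predU1P[<-//|t0].
    by apply: cvg_at_right_filter; apply: c1; rewrite in_itv/= t0.
  + by apply: (cvg_comp y F); [exact: c3|apply: cF; exact: lt_trans uy].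
rewrite /= yt => ->.
have [l dl lrho] := dFy _ ctT.
rewrite derive1E derive_val.
apply: (@le_trans _ _ (rho * (T - t))); last first.
  by rewrite ler_wpM2l// gerBl.
by rewrite ler_wpM2r// subr_ge0 ltW.
Qed.

(** F is unbounded below near s, so climbing to a level above s from levels close to s would take
    arbitrarily long. *)
Lemma subsolution_stuck (H F y : R -> R) (s rho T : R) :
  (forall v, s < v -> 0 < H v) ->
  (forall v, s < v -> is_derive v 1 F (H v)^-1) ->
  (forall A, exists2 u, s < u & F u < A) ->
  subsolution H s rho T y -> y T <= s.
Proof.
move=> H0 dF Finf yH; rewrite leNgt; apply/negP => sy.
(* The second bound contradicts the travel time if u < y T; the first contradicts the monotonicity
   of F if y T <= u. *)
have [u su Fu] := Finf (Num.min (F (y T)) (F (y T) - rho * T)).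
move: Fu; rewrite lt_min => /andP[Fu1 Fu2].
have [uy|yu] := ltP u (y T).
  by have := subsolution_travel_time H0 dF yH su uy; lra.
suff : F (y T) <= F u by lra.
have [||c /itvP cs] := @MVT_segment R F (fun v => (H v)^-1) (y T) u yu.
- by move=> x /itvP xyu; apply: dF; rewrite (lt_trans sy)// xyu.
- apply: (is_derive_within_continuous (f' := fun v => (H v)^-1)) => x /andP[yx _].
  by apply: dF; exact: lt_le_trans yx.
move=> e; rewrite -subr_ge0 e mulr_ge0 ?subr_ge0// invr_ge0 ltW//.
by apply: H0; rewrite (lt_le_trans sy)// cs.
Qed.

End calculus.

(** * The maximal solution of the scalar equation *)

Section flow_existence.
Context {R : realType}.
Implicit Types (G F g y : R -> R) (s t u : R).

(** Domination concerns all subsolutions of all speeds, not only solutions: a path of speed [rho]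
    and duration [T] is compared with time [rho * T]. *)
Definition supersolution G s (gam : R -> \bar R) : Prop :=
  (forall rho T y, subsolution G s rho T y -> ((y T)%:E <= gam (rho * T)%R)%E) /\
  (forall t u, 0 <= t -> t <= u -> (gam t <= gam u)%E).

Definition blowup_solution G s (gam : R -> \bar R) (tau : \bar R) : Prop :=
  [/\ (0 < tau)%E,
      forall t : R, 0 <= t -> (t%:E < tau)%E -> gam t \is a fin_num,
      nonneg_solution G s tau (fine \o gam),
      forall T : R, tau = T%:E -> gam t @[t --> T^'-] --> +oo%E
    & forall t : R, (tau <= t%:E)%E -> gam t = +oo%E].

(** The stationary case: if nothing can leave s, the constant s is the largest solution, with
    infinite lifetime. *)
Lemma constant_flow G s : 0 <= s -> G s = 0 ->
  (forall rho T y, subsolution G s rho T y -> y T <= s) ->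
  exists2 gam, supersolution G s gam & exists tau, blowup_solution G s gam tau.
Proof.
move=> s0 Gs ys; exists (fun=> s%:E).
  by split=> [rho T y /ys|//]; rewrite lee_fin.
exists +oo%E; split => //; split => //=.
- rewrite Gs (_ : (fun _ => _) = fun=> 0); first exact: cvg_cst.
  by apply/funext => h; rewrite subrr mulr0.
- by move=> t _ _; rewrite Gs; exact: is_derive_cst.
Qed.

(* [F - L] is the time needed to travel from [s] along the equation. When it is
   finite, its inverse is the solution that leaves [s] immediately. *)
Section inverse_flow.
Variables (G F : R -> R) (s l : R).
Hypotheses (s0 : 0 <= s) (Gcont : {within `[0, +oo[, continuous G}).
Hypothesis Gndec : forall u v, 0 <= u -> u <= v -> G u <= G v.
Hypothesis Gpos : forall u, s < u -> 0 < G u.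
Hypothesis dF : forall u, s < u -> is_derive u 1 F (G u)^-1.
Hypothesis Flb : forall u, s < u -> l <= F u.

(** This is the limit of F at s from the right, F being increasing. *)
Let L := inf (F @` [set u | s < u]).

Let F_incr u v : s < u -> u < v -> F u < F v.
Proof.
move=> su uv; have [||c /itvP cuv] := @MVT R F (fun x => (G x)^-1) u v uv.
- by move=> x /itvP xuv; apply: dF; rewrite (lt_trans su)// xuv.
- apply: (is_derive_within_continuous (f' := fun x => (G x)^-1)) => x /andP[ux _].
  by apply: dF; exact: lt_le_trans ux.
move=> e; rewrite -subr_gt0 e mulr_gt0 ?subr_gt0// invr_gt0.
by apply: Gpos; rewrite (lt_trans su)// cuv.
Qed.

Let F_le u v : s < u -> s < v -> F u <= F v -> u <= v.
Proof.
by move=> su sv; rewrite !leNgt; apply: contra => vu; exact: F_incr.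
Qed.

Let has_infF : has_inf (F @` [set u | s < u]).
Proof.
split; first by exists (F (s + 1)), (s + 1) => //=; rewrite ltrDl.
by exists l => _ [u /= su <-]; exact: Flb.
Qed.

Let L_lt u : s < u -> L < F u.
Proof.
move=> su; have [h1 h2] := midf_lt su.
by apply: le_lt_trans (F_incr h1 h2); apply: (inf_lbound has_infF.2); exists ((s + u) / 2).
Qed.

Let near_L e : 0 < e -> exists2 u, s < u & F u < L + e.
Proof.
by move=> e0; have [_ [u /= su <-] Fu] := inf_adherent e0 has_infF; exists u.
Qed.

Let F_surj u v x : s < u -> s < v -> F u <= x <= F v -> exists2 w, s < w & F w = x.
Proof.
move=> su sv /andP[ux xv]; have uv : u <= v by apply: F_le => //; exact: le_trans xv.
have [||w /itvP wuv Fw] := @IVT R F u v x uv.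
- apply: (is_derive_within_continuous (f' := fun x => (G x)^-1)) => z /andP[uz _].
  by apply: dF; exact: lt_le_trans uz.
- by rewrite ge_min ux/= le_max xv orbT.
by exists w => //; rewrite (lt_le_trans su)// wuv.
Qed.

Let P t := [set u | s < u /\ F u = L + t].

(** The level reached after time t; if no level lies at travel time t > 0 from s, infinity has been
    reached. *)
Let gam t : \bar R :=
  if t <= 0 then s%:E else if `[< exists u, P t u >] then (get (P t))%:E else +oo%E.

Let gam0 : gam 0 = s%:E. Proof. by rewrite /gam lexx. Qed.

Let gam_F u : s < u -> gam (F u - L) = u%:E.
Proof.
move=> su; rewrite /gam leNgt subr_gt0 L_lt//=.
have Pu : P (F u - L) u by split => //; rewrite addrC subrK.
case: ifPn => [_|/asboolPn]; last by move=> /(_ (ex_intro _ u Pu)).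
have [sg Fg] := getPex (ex_intro _ u Pu).
have {}Fg : F (get (P (F u - L))) = F u by rewrite Fg addrC subrK.
by congr (_%:E); apply/eqP; rewrite eq_le; apply/andP; split; apply: F_le => //; rewrite Fg.
Qed.

Let gam_cases t : 0 < t ->
  (exists u, [/\ s < u, F u = L + t & gam t = u%:E]) \/
  (gam t = +oo%E /\ forall u, s < u -> F u < L + t).
Proof.
move=> t0; have [[u [su Fu]]|noP] := pselect (exists u, P t u).
  by left; exists u; split => //; rewrite -(gam_F su) Fu addrC addKr.
right; split; first by rewrite /gam leNgt t0/=; case: asboolP.
move=> u su; rewrite ltNge; apply/negP => Fu.
have [v sv Fv] := near_L t0.
have [|w sw Fw] := F_surj (x := L + t) sv su; first by rewrite (ltW Fv).
by apply: noP; exists w.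
Qed.

Let tau := ereal_sup [set (F u - L)%R%:E | u in [set u | s < u]].

(** Strict, because the level u + 1 is reached later than u: the supremum is not attained. *)
Let tau_ge u : s < u -> ((F u - L)%R%:E < tau)%E.
Proof.
move=> su; have su1 : s < u + 1 by rewrite (lt_trans su)// ltrDl.
apply: (@lt_le_trans _ _ (F (u + 1) - L)%R%:E).
  by rewrite lte_fin ltrD2r F_incr// ltrDl.
by apply: ereal_sup_ubound; exists (u + 1).
Qed.

Let lt_tau t : 0 < t -> (t%:E < tau)%E ->
  exists u, [/\ s < u, F u = L + t & gam t = u%:E].
Proof.
move=> t0 /ereal_sup_gt[_ [u /= su <-]]; rewrite lte_fin => tF.
by have [//|[_ /(_ _ su)]] := gam_cases t0; rewrite addrC -ltrBlDr ltNge (ltW tF).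
Qed.

Let gam_nd t u : 0 <= t -> t <= u -> (gam t <= gam u)%E.
Proof.
rewrite le_eqVlt => /predU1P[<-|t0].
  rewrite gam0 le_eqVlt => /predU1P[<-|u0]; first by rewrite gam0.
  by have [[v [sv _ ->]]|[-> _]] := gam_cases u0; rewrite ?leey// lee_fin ltW.
move=> tu; have u0 := lt_le_trans t0 tu.
have [[w [sw Fw ->]]|[-> Fu]] := gam_cases u0; last by rewrite leey.
have [[v [sv Fv ->]]|[-> Fv]] := gam_cases t0.
  by rewrite lee_fin; apply: F_le => //; rewrite Fv Fw lerD2l.
by have := Fv _ sw; rewrite Fw ltrD2l ltNge tu.
Qed.

Let gam_ge_subsolution rho T y :
  subsolution G s rho T y -> ((y T)%:E <= gam (rho * T)%R)%E.
Proof.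
move=> yG; have [rho0 T0 _ _ _] := yG; have rT : 0 <= rho * T by exact: mulr_ge0.
have [ys|sy] := leP (y T) s.
  by apply: le_trans (gam_nd (lexx 0) rT); rewrite gam0 lee_fin.
have FL : F (y T) <= L + rho * T.
  (* The travel time from u to y T is at most rho T; u is taken so close to s that F u is within e
     of L. *)
  apply/ler_addgt0Pr => e e0; have [u su Fu] := near_L e0.
  have [uy|yu] := ltP u (y T).
    by have := subsolution_travel_time Gpos dF yG su uy; lra.
  move: yu; rewrite le_eqVlt => /predU1P[->|/(F_incr sy)]; lra.
have {}rT : 0 < rho * T by have := L_lt sy; lra.
have [[u [su Fu ->]]|[-> _]] := gam_cases rT; last by rewrite leey.
by rewrite lee_fin; apply: F_le => //; rewrite Fu.
Qed.

Let g := fine \o gam.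

Let g_F u : s < u -> g (F u - L) = u.
Proof. by move=> su; rewrite /g /= gam_F. Qed.

Let dg t : 0 < t -> (t%:E < tau)%E -> is_derive t 1 g (G (g t)).
Proof.
move=> t0 tt; have [u [su Fu gu]] := lt_tau t0 tt.
have tE : t = F u - L by rewrite Fu addrC addKr.
have dFL v : s < v -> is_derive v 1 (fun x => F x - L) (G v)^-1.
  by move=> sv; rewrite -[(G v)^-1]subr0; have := dF sv => ?; exact: is_deriveB.
rewrite tE g_F// -[G u]invrK.
apply: (@is_derive_inverse _ (fun v => F v - L)).
- have : \forall v \near u, s < v by exact: lt_nbhsr.
  by apply: filterS => v sv /=; exact: g_F.
- have : \forall v \near u, s < v by exact: lt_nbhsr.
  apply: filterS => v sv; exact: is_derive_continuous (dFL _ sv).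
- exact: dFL.
- by rewrite invr_neq0// gt_eqF// Gpos.
Qed.

Let g_gt t : 0 < t -> (t%:E < tau)%E -> s < g t.
Proof. by move=> t0 /(lt_tau t0)[u [su _ gu]]; rewrite /g /= gu. Qed.

Let g_right : g h @[h --> 0^'+] --> s.
Proof.
apply/cvgrPdist_lt => e e0; have se : s < s + e by rewrite ltrDl.
have : \forall h \near 0^'+, h < F (s + e) - L.
  by apply: nbhs_right_lt; rewrite subr_gt0 L_lt.
have : \forall h \near (0 : R)^'+, 0 < h by exact: nbhs_right_gt.
apply: filterS2 => h h0 hF.
have ht : (h%:E < tau)%E by apply: lt_trans (tau_ge se); rewrite lte_fin.
have [u [su Fu gu]] := lt_tau h0 ht; rewrite /g /= gu /=.
have us : u < s + e.
  by rewrite ltNge; apply/negP; rewrite le_eqVlt => /predU1P[ue|/(F_incr se)];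
    [move: hF; rewrite ue Fu|]; lra.
by rewrite distrC gtr0_norm ?subr_gt0//; lra.
Qed.

Let tau0 : (0 < tau)%E.
Proof.
have s1 : s < s + 1 by rewrite ltrDl.
by apply: lt_trans (tau_ge s1); rewrite lte_fin subr_gt0 L_lt.
Qed.

Let Gg_right : G (g h) @[h --> 0^'+] --> G s.
Proof.
have /continuous_within_itvcyP[Gin G0] := Gcont.
have near_tau : \forall h \near (0 : R)^'+, (h%:E < tau)%E.
  have s1 : s < s + 1 by rewrite ltrDl.
  have : \forall h \near 0^'+, h < F (s + 1) - L.
    by apply: nbhs_right_lt; rewrite subr_gt0 L_lt.
  by apply: filterS => h hF; apply: lt_trans (tau_ge s1); rewrite lte_fin.
have near_pos : \forall h \near (0 : R)^'+, 0 < h by exact: nbhs_right_gt.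
(* Since g approaches s strictly from above, right continuity of G at s is enough; at s = 0 it is
   all that is given. *)
have gr : g h @[h --> 0^'+] --> s^'+.
  move=> A /= [e /= e0 sA].
  have /cvgrPdist_lt/(_ _ e0) := g_right.
  move: near_tau near_pos; apply: filterS3 => h ht h0 hg.
  by apply: sA => //=; exact: g_gt.
apply: cvg_comp gr _.
move: (s0); rewrite le_eqVlt => /predU1P[<-//|spos].
by apply: cvg_at_right_filter; apply: Gin; rewrite in_itv/= spos.
Qed.

(** By the mean value theorem the quotient is G (g c) with 0 < c < h, which monotonicity squeezes
    between G s and G (g h). *)
Let g_right_derivative : h^-1 * (g h - g 0) @[h --> 0^'+] --> G (g 0).
Proof.
have g00 : g 0 = s by rewrite /g /= gam0.
have s1 : s < s + 1 by rewrite ltrDl.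
rewrite g00; apply: (@squeeze_cvgr _ _ _ _ (fun=> G s) (fun h => G (g h))).
- have : \forall h \near 0^'+, h < F (s + 1) - L.
    by apply: nbhs_right_lt; rewrite subr_gt0 L_lt.
  have : \forall h \near (0 : R)^'+, 0 < h by exact: nbhs_right_gt.
  apply: filterS2 => h h0 hF.
  have ht : (h%:E < tau)%E by apply: lt_trans (tau_ge s1); rewrite lte_fin.
  have lt_h x : x <= h -> (x%:E < tau)%E.
    by move=> xh; apply: le_lt_trans ht; rewrite lee_fin.
  have [||c /itvP c0h gc] := @MVT R g (fun x => G (g x)) 0 h h0.
  + by move=> x /itvP x0h; apply: dg; [rewrite x0h|apply: lt_h; rewrite x0h].
  + apply/continuous_within_itvP => //; split.
    * move=> x /itvP x0h; apply: is_derive_continuous; apply: dg; first by rewrite x0h.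
      by apply: lt_h; rewrite x0h.
    * by rewrite g00; exact: g_right.
    * by apply: cvg_at_left_filter; apply: is_derive_continuous; exact: dg.
  have ct : (c%:E < tau)%E by apply: lt_h; rewrite c0h.
  have sc : s < g c by apply: g_gt => //; rewrite c0h.
  rewrite -g00 gc subr0 mulrC mulfK ?gt_eqF// g00 !Gndec//= ?(ltW sc)//.
    by rewrite (le_trans s0)// ltW.
  have := gam_nd (t := c) (u := h); rewrite !c0h => /(_ isT isT).
  have c0 : 0 < c by rewrite c0h.
  have [v [sv Fv gv]] := lt_tau c0 ct; have [w [sw Fw gw]] := lt_tau h0 ht.
  by rewrite /g /= gv gw lee_fin.
- exact: cvg_cst.
- exact: Gg_right.
Qed.

Lemma inverse_flow :
  exists2 gam, supersolution G s gam & exists tau, blowup_solution G s gam tau.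
Proof.
have gam_lt t : 0 <= t -> (t%:E < tau)%E -> gam t = (g t)%:E /\ s <= g t.
  rewrite le_eqVlt => /predU1P[<- _|t0 tt]; first by rewrite /g /= gam0.
  by have [u [su _ gu]] := lt_tau t0 tt; rewrite /g /= gu/= ltW.
exists gam; first by split; [exact: gam_ge_subsolution|exact: gam_nd].
exists tau; split => //.
- by move=> t t0 tt; have [-> _] := gam_lt _ t0 tt.
- split => //.
  + by rewrite /g /= gam0.
  + by move=> t t0 tt; have [_ sg] := gam_lt _ t0 tt; exact: le_trans sg.
- move=> T tT; apply/cvgeyPge => A.
  pose u := Num.max (s + 1) A; have su : s < u by rewrite lt_max ltrDl ltr01.
  have := tau_ge su; rewrite tT lte_fin => FT.
  have near1 := nbhs_left_gt FT; apply: filterS near1 => t Ft.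
  apply: (@le_trans _ _ u%:E); first by rewrite lee_fin le_max lexx orbT.
  by rewrite -(gam_F su); apply: gam_nd; [rewrite subr_ge0 ltW// L_lt|exact: ltW].
- move=> t tt.
  have t0 : 0 < t by rewrite -lte_fin (lt_le_trans tau0).
  have [[u [su Fu _]]|[]//] := gam_cases t0.
  have := tau_ge su; rewrite Fu (_ : L + t - L = t); last by lra.
  by rewrite ltNge tt.
Qed.

End inverse_flow.

(** Osgood's criterion. If G vanishes at some v > s, it vanishes on [s, v] and s is stationary.
    Otherwise 1 / G has an antiderivative F above s: bounded below, it can be inverted; unbounded
    below, it makes s stationary again. *)
Lemma exists_flow G s : 0 <= s -> {within `[0, +oo[, continuous G} ->
  (forall u, 0 <= u -> 0 <= G u) ->
  (forall u v, 0 <= u -> u <= v -> G u <= G v) ->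
  exists2 gam, supersolution G s gam & exists tau, blowup_solution G s gam tau.
Proof.
move=> s0 Gcont G0 Gndec.
have [[v sv Gv]|noG] := pselect (exists2 v, s < v & G v = 0).
  have Gs : G s = 0.
    by apply/eqP; rewrite eq_le G0// andbT -Gv Gndec// ltW.
  apply: (constant_flow s0 Gs) => rho T y yG.
  have [rho0 T0 cy y0 dy] := yG.
  have [m _ ym] := EVT_max T0 cy.
  (* Up to the maximum of [y], the function [G] lies below the linear function
     [C (u - s)], for which [s] cannot be left in finite time. *)
  pose C := (G (Num.max s (y m)) + 1) / (v - s).
  have vs : 0 < v - s by rewrite subr_gt0.
  have Gm : 0 <= G (Num.max s (y m)) by apply: G0; rewrite le_max s0.
  have C0 : 0 < C by rewrite divr_gt0// ltr_wpDl.
  have CE : C * (v - s) = G (Num.max s (y m)) + 1 by rewrite divfK// gt_eqF.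
  clearbody C.
  apply: (@subsolution_stuck _ (fun u => C * (u - s)) (fun u => C^-1 * ln (u - s))
    y s rho T).
  - by move=> u su; rewrite mulr_gt0// subr_gt0.
  - move=> u su; have us : 0 < u - s by rewrite subr_gt0.
    rewrite [X in is_derive _ _ _ X](_ : _ = C^-1 * (u - s)^-1); last by rewrite invfM.
    have d1 : is_derive u 1 (fun x => x - s) 1.
      by rewrite -[X in is_derive _ _ _ X]subr0; apply: is_deriveB.
    have := @is_derive1_comp R (@ln R) (fun x => x - s) u _ _ (is_derive1_ln us) d1.
    rewrite mulr1 => d2.
    have d3 := is_deriveZ C^-1 d2; exact d3.
  (* The level at which the logarithmic antiderivative equals A - 1. *)
  - move=> A; exists (s + expR (C * (A - 1))); first by rewrite ltrDl expR_gt0.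
    by rewrite addrAC subrr add0r expRK mulKf ?gt_eqF// ltrBlDr ltrDl.
  - split => // t tT st; have [l dl lG] := dy t tT st.
    exists l => //; apply: le_trans lG _; rewrite ler_wpM2l//.
    (* Up to v the function G vanishes; beyond v, C (y t - s) >= C (v - s), which exceeds G at the
       maximum of y. *)
    have [yv|vy] := leP (y t) v.
      apply: (@le_trans _ _ 0); first by rewrite -Gv Gndec// (le_trans s0)// ltW.
      by rewrite mulr_ge0 ?(ltW C0)// subr_ge0 ltW.
    apply: (@le_trans _ _ (C * (v - s))); last by rewrite ler_wpM2l ?(ltW C0)// lerB// ltW.
    rewrite CE; apply: (@le_trans _ _ (G (Num.max s (y m)))); last first.
      by rewrite lerDl.
    apply: Gndec; first by rewrite (le_trans s0)// ltW.
    rewrite le_max ym ?orbT// in_itv/=.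
    by move: tT => /andP[? ?]; rewrite !ltW.
have Gpos u : s < u -> 0 < G u.
  move=> su; rewrite lt_neqAle G0 ?(le_trans s0 (ltW su))// andbT eq_sym.
  by apply/eqP => Gu; apply: noG; exists u.
have [|F dF] := @antiderivative_gt R (fun u => (G u)^-1) s.
  move=> u su; apply: cvgV; first by rewrite gt_eqF// Gpos.
  have /continuous_within_itvcyP[Gin _] := Gcont.
  by apply: Gin; rewrite in_itv/= andbT (le_lt_trans s0).
have [[l Fl]|noF] := pselect (exists l, forall u, s < u -> l <= F u).
  exact: (inverse_flow s0 Gcont Gndec Gpos dF Fl).
have Finf A : exists2 u, s < u & F u < A.
  apply: contrapT => nA; apply: noF; exists A => u su.
  by rewrite leNgt; apply/negP => Fu; apply: nA; exists u.
(* If G s were positive, 1 / G would be at most 1 / G s above s, and F would drop by at most 1 / G s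
   between s + 1 and s. *)
have Gs : G s = 0.
  apply/eqP; rewrite eq_le G0// andbT leNgt; apply/negP => Gs.
  apply: noF; exists (F (s + 1) - (G s)^-1) => u su.
  have s1 : s < s + 1 by rewrite ltrDl.
  have [us|su1] := leP u (s + 1).
    have [||c /itvP uc e] := @MVT_segment R F (fun x => (G x)^-1) u (s + 1) us.
    - by move=> x /itvP xus; apply: dF; rewrite (lt_trans su)// xus.
    - apply: (is_derive_within_continuous (f' := fun x => (G x)^-1)) => x /andP[ux _].
      by apply: dF; exact: lt_le_trans ux.
    suff : (G c)^-1 * (s + 1 - u) <= (G s)^-1 by rewrite -e; lra.
    have sc : s < c by rewrite (lt_le_trans su)// uc.
    rewrite -[leRHS]mulr1; apply: ler_pM.
    - by rewrite invr_ge0 ltW// Gpos.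
    - by rewrite subr_ge0.
    - have Gc := Gpos _ sc; by rewrite lef_pV2 ?posrE// Gndec// ltW.
    - by lra.
  apply: (@le_trans _ _ (F (s + 1))); first by rewrite gerBl invr_ge0 ltW.
  have [||c /itvP uc e] := @MVT_segment R F (fun x => (G x)^-1) (s + 1) u (ltW su1).
  - by move=> x /itvP xus; apply: dF; rewrite (lt_trans s1)// xus.
  - apply: (is_derive_within_continuous (f' := fun x => (G x)^-1)) => x /andP[ux _].
    by apply: dF; exact: lt_le_trans ux.
  rewrite -subr_ge0 e mulr_ge0 ?invr_ge0 ?subr_ge0 ?(ltW su1)//.
  by rewrite ltW// Gpos// (lt_le_trans s1)// uc.
by apply: (constant_flow s0 Gs) => rho T y; exact: subsolution_stuck Gpos dF Finf.
Qed.

(** * Comparison with the chosen maximal solution *)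

Lemma nonneg_solution_right_continuous G s tau g :
  nonneg_solution G s tau g -> g h @[h --> 0^'+] --> g 0.
Proof.
move=> [_ _ g0 _].
have : g 0 + h * (h^-1 * (g h - g 0)) @[h --> 0^'+] --> g 0 + 0 * G (g 0).
  apply: cvgD; first exact: cvg_cst.
  by apply: cvgM g0; apply: cvg_at_right_filter; exact: cvg_id.
rewrite mul0r addr0 => H; refine (cvg_trans (near_eq_cvg _) H).
have : \forall h \near (0 : R)^'+, 0 < h by exact: nbhs_right_gt.
by apply: filterS => h h0; rewrite mulVKf ?gt_eqF// addrC subrK.
Qed.

Lemma nonneg_solution_continuous G s tau g T :
  nonneg_solution G s tau g -> 0 <= T -> (T%:E < tau)%E ->
  {within `[0, T], continuous g}.
Proof.
move=> gsol; rewrite le_eqVlt => /predU1P[<- _|T0 Ttau].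
  by rewrite set_itv1; exact: continuous_subspace1.
have cg t : 0 < t -> t <= T -> {for t, continuous g}.
  move=> t0 tT; have [_ _ _ dg] := gsol.
  apply: is_derive_continuous; apply: dg => //.
  by apply: le_lt_trans Ttau; rewrite lee_fin.
apply/continuous_within_itvP => //; split.
- by move=> t /itvP t0T; apply: cg; rewrite t0T.
- exact: nonneg_solution_right_continuous gsol.
- by apply: cvg_at_left_filter; exact: cg.
Qed.

Lemma nonneg_solution_nondecreasing G s tau g t u :
  (forall u, 0 <= u -> 0 <= G u) ->
  nonneg_solution G s tau g -> 0 <= t -> t <= u -> (u%:E < tau)%E -> g t <= g u.
Proof.
move=> G0 gsol t0 tu utau.
have [_ gge0 _ dg] := gsol.
have dgu x : x \in `]0, u[ -> is_derive x 1 g (G (g x)) /\ 0 <= g x.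
  move=> /itvP xu; have xtau : (x%:E < tau)%E.
    by apply: le_lt_trans utau; rewrite lee_fin xu.
  by split; [apply: dg; rewrite ?xu|apply: gge0; rewrite ?xu].
apply: (@ger0_derive1_ndecr R g 0 u) => //.
- by move=> x /dgu[[]].
- by move=> x /dgu[d1 g0]; rewrite derive1E derive_val G0.
- by apply: nonneg_solution_continuous gsol _ utau; exact: le_trans tu.
Qed.

Lemma nonneg_solution_subsolution G s tau g T :
  nonneg_solution G s tau g -> 0 <= T -> (T%:E < tau)%E ->
  subsolution G s 1 T g.
Proof.
move=> gsol T0 Ttau; have [gs _ _ dg] := gsol; split => //.
- exact: nonneg_solution_continuous gsol T0 Ttau.
- by rewrite gs.
move=> t /andP[t0 tT] _; exists (G (g t)); last by rewrite mul1r.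
by apply: dg => //; apply: lt_trans Ttau; rewrite lte_fin.
Qed.

(** The choice behind [flow] is meaningful once a maximal solution exists; the constructed one
    qualifies because every solution is a subsolution of speed 1. *)
Lemma maximal_solution_flow G s : 0 <= s -> {within `[0, +oo[, continuous G} ->
  (forall u, 0 <= u -> 0 <= G u) ->
  (forall u v, 0 <= u -> u <= v -> G u <= G v) ->
  maximal_solution G s (fun t => flow G t s).
Proof.
move=> s0 Gcont G0 Gndec.
have [gam [gam_sub _] [tau gam_sol]] := exists_flow s0 Gcont G0 Gndec.
apply: (@getPex _ (maximal_solution G s)).
exists gam; split; first by exists tau.
move=> T g T0 gsol t t0 tT; rewrite -[t in gam t]mul1r; apply: gam_sub.
exact: nonneg_solution_subsolution gsol t0 tT.
Qed.

(** Subsolutions are dominated by the constructed [gam], whereas [flow] is only known to dominate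
    solutions. So [gam] <= [flow] before the blow-up of [gam], and [flow] cannot stay finite beyond
    it. *)
Lemma flow_ge_subsolution G s rho T r y :
  0 <= s -> {within `[0, +oo[, continuous G} ->
  (forall u, 0 <= u -> 0 <= G u) ->
  (forall u v, 0 <= u -> u <= v -> G u <= G v) ->
  subsolution G s rho T y -> rho * T <= r -> ((y T)%:E <= flow G r s)%E.
Proof.
move=> s0 Gcont G0 Gndec yG rTr; have [rho0 T0 _ _ _] := yG.
have r0 : 0 <= r by apply: le_trans rTr; exact: mulr_ge0.
have [gam [gam_sub gam_nd] [tau [tau0 gam_fin gam_sol gam_blow gam_oo]]] :=
  exists_flow s0 Gcont G0 Gndec.
have [[tau' [_ fin' sol' _ oo']] dom'] := maximal_solution_flow s0 Gcont G0 Gndec.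
apply: le_trans (gam_sub _ _ _ yG) _.
apply: le_trans (gam_nd _ _ (mulr_ge0 rho0 T0) rTr) _.
have le_lt t : 0 <= t -> (t%:E < tau)%E -> (gam t <= flow G t s)%E.
  move=> t0 tt; rewrite -(fineK (gam_fin _ t0 tt)).
  exact: (dom' _ _ tau0 gam_sol).
have [rtau|taur] := ltP r%:E tau; first exact: le_lt.
have [r'|/oo' ->] := ltP r%:E tau'; last by rewrite leey.
have [T1 T1E] : exists T1, tau = T1%:E.
  by move: tau0 taur; case: (tau) => [x||]//; exists x.
have T10 : 0 < T1 by rewrite -lte_fin -T1E.
have T1r : T1 <= r by rewrite -lee_fin -T1E.
(* A finite value of the nondecreasing [flow] at r >= T1 would bound [gam] to the left of its
   blow-up time T1. *)
have /cvgeyPgt/(_ (fine (flow G r s))) near1 := gam_blow _ T1E.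
exfalso.
have near2 : \forall t \near T1^'-, 0 < t by exact: nbhs_left_gt.
have near3 : \forall t \near T1^'-, t < T1 by exact: nbhs_left_lt.
near T1^'- => t.
have t0 : 0 < t by near: t.
have tT1 : t < T1 by near: t.
have tr : t <= r by exact: le_trans (ltW tT1) T1r.
have tt' : (t%:E < tau')%E by apply: le_lt_trans r'; rewrite lee_fin.
have : ((fine (flow G r s))%:E < gam t)%E by near: t.
apply/negP; rewrite -leNgt; apply: le_trans (le_lt _ (ltW t0) _) _.
  by rewrite T1E lte_fin.
rewrite -(fineK (fin' _ (ltW t0) tt')) lee_fin.
exact: (nonneg_solution_nondecreasing G0 sol' (ltW t0) tr r').
Unshelve. all: by end_near. Qed.

End flow_existence.

(** * The Euclidean norm and derivatives along a line *)

Section euclidean_norm.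
Context {R : realType} {n : nat}.
Implicit Types (u v : 'rV[R]_n) (A : 'M[R]_n).

Definition dotv u v : R := \sum_i u ord0 i * v ord0 i.

Lemma enorm_ge0 v : 0 <= enorm v.
Proof. exact: sqrtr_ge0. Qed.

Lemma sqr_enorm v : enorm v ^+ 2 = \sum_i v ord0 i ^+ 2.
Proof. by rewrite sqr_sqrtr// sumr_ge0// => i _; exact: sqr_ge0. Qed.

Lemma enorm0_coord v i : enorm v = 0 -> v ord0 i = 0.
Proof.
move=> v0; have /eqP : \sum_i v ord0 i ^+ 2 = 0 by rewrite -sqr_enorm v0 expr0n.
rewrite psumr_eq0; last by move=> j _; exact: sqr_ge0.
by move=> /allP/(_ i); rewrite mem_index_enum sqrf_eq0 => /(_ isT)/eqP.
Qed.

Lemma enormZ (a : R) v : enorm (a *: v) = `|a| * enorm v.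
Proof.
rewrite /enorm -sqrtr_sqr -sqrtrM ?sqr_ge0// mulr_sumr; congr Num.sqrt.
by apply: eq_bigr => i _; rewrite mxE exprMn.
Qed.

(** Cauchy-Schwarz, by expanding the squared norm of |v| u - |u| v. *)
Lemma dotv_le u v : dotv u v <= enorm u * enorm v.
Proof.
have [u0|u0] := eqVneq (enorm u) 0.
  by rewrite u0 mul0r /dotv big1// => i _; rewrite enorm0_coord// mul0r.
have [v0|v0] := eqVneq (enorm v) 0.
  by rewrite v0 mulr0 /dotv big1// => i _; rewrite (enorm0_coord _ v0) mulr0.
set a := enorm u in u0 *; set b := enorm v in v0 *.
have a0 : 0 < a by rewrite lt_neqAle eq_sym u0 enorm_ge0.
have b0 : 0 < b by rewrite lt_neqAle eq_sym v0 enorm_ge0.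
have : 0 <= \sum_i (b * u ord0 i - a * v ord0 i) ^+ 2.
  by apply: sumr_ge0 => i _; exact: sqr_ge0.
have -> : \sum_i (b * u ord0 i - a * v ord0 i) ^+ 2 =
    2 * (a * b) * (a * b - dotv u v).
  transitivity (b ^+ 2 * (\sum_i u ord0 i ^+ 2) + a ^+ 2 * (\sum_i v ord0 i ^+ 2) -
      2 * (a * b) * dotv u v).
    rewrite /dotv !mulr_sumr -big_split/= -sumrB; apply: eq_bigr => i _; ring.
  by rewrite -!sqr_enorm -/a -/b; ring.
by rewrite pmulr_rge0 ?subr_ge0// !mulr_gt0.
Qed.

(** The supremum in [opnorm] is an upper bound only if its set is bounded. The Frobenius norm bounds
    it, by Cauchy-Schwarz on each column, applied to w and - w since [dotv_le] is one-sided. *)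
Lemma enorm_le_opnorm A v : enorm (v *m A) <= opnorm A * enorm v.
Proof.
have bounded : has_sup [set enorm (v *m A) | v in [set v : 'rV[R]_n | enorm v <= 1]].
  split; first by exists (enorm (0 *m A)), 0 => //=; rewrite -(scale0r 0) enormZ normr0 mul0r.
  exists (Num.sqrt (\sum_j \sum_k A k j ^+ 2)) => _ [w /= w1 <-].
  rewrite /enorm ler_sqrt; last first.
    by apply: sumr_ge0 => j _; apply: sumr_ge0 => k _; exact: sqr_ge0.
  apply: ler_sum => j _; pose c := \row_k A k j.
  have c2 : \sum_k A k j ^+ 2 = enorm c ^+ 2.
    by rewrite sqr_enorm; apply: eq_bigr => k _; rewrite mxE.
  have wAE (w' : 'rV[R]_n) : (w' *m A) ord0 j = dotv w' c.
    by rewrite mxE; apply: eq_bigr => k _; rewrite mxE.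
  have wc : enorm w * enorm c <= enorm c by rewrite ler_piMl ?enorm_ge0.
  have mwc : enorm (- w) * enorm c <= enorm c.
    by rewrite -scaleN1r enormZ normrN1 mul1r.
  have y1 := le_trans (dotv_le w c) wc.
  have y2 := le_trans (dotv_le (- w) c) mwc.
  have dN : dotv (- w) c = - dotv w c.
    by rewrite /dotv -sumrN; apply: eq_bigr => k _; rewrite mxE mulNr.
  rewrite c2 wAE -subr_ge0 subr_sqr mulr_ge0 ?subr_ge0//.
  by move: y2; rewrite dN lerNl -subr_ge0 opprK addrC.
have [v0|v0] := eqVneq (enorm v) 0.
  rewrite v0 mulr0; have -> : v = 0.
    by apply/rowP => i; rewrite mxE enorm0_coord.
  by rewrite mul0mx -(scale0r 0) enormZ normr0 mul0r.
have vpos : 0 < enorm v by rewrite lt_neqAle eq_sym v0 enorm_ge0.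
rewrite -ler_pdivrMr//.
apply: (sup_upper_bound bounded); exists ((enorm v)^-1 *: v).
  by rewrite /= enormZ ger0_norm ?invr_ge0 ?enorm_ge0// mulVf.
by rewrite -scalemxAl enormZ ger0_norm ?invr_ge0 ?enorm_ge0// mulrC.
Qed.

End euclidean_norm.

Section line.
Context {R : realType} {n : nat}.
Variables (x v : 'rV[R]_n).

Lemma is_derive_line (W : normedModType R) (f : 'rV[R]_n -> W) t :
  differentiable f (x + t *: v) ->
  is_derive t 1 (fun t => f (x + t *: v)) ('D_v f (x + t *: v)).
Proof.
move=> df.
have E : (fun h : R => h^-1 *: (((fun t => f (x + t *: v)) \o shift t) (h *: 1) -
    f (x + t *: v))) =
    (fun h : R => h^-1 *: ((f \o shift (x + t *: v)) (h *: v) - f (x + t *: v))).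
  apply/funext => h /=; congr (_ *: (f _ - _)).
  have -> : h *: (1 : R) = h by exact: mulr1.
  by rewrite scalerDl addrCA.
apply: DeriveDef.
  by rewrite /derivable E; exact: diff_derivable.
by rewrite /derive E.
Qed.

Lemma dotv_gradient (U : 'rV[R]_n -> R) p : differentiable U p ->
  'D_v U p = dotv (gradient U p) v.
Proof.
move=> dU; rewrite deriveE// {1}(row_sum_delta v) linear_sum /dotv.
by apply: eq_bigr => i _; rewrite linearZ/= mxE deriveE// mulrC.
Qed.

Lemma is_derive_gradient (U : 'rV[R]_n -> R) t i :
  differentiable (gradient U) (x + t *: v) ->
  is_derive t 1 (fun t => gradient U (x + t *: v) ord0 i)
    ((v *m hessian U (x + t *: v)) ord0 i).
Proof.
move=> dg; have [d1 d2] := is_derive_line dg.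
apply: DeriveDef; first by have /derivable_mxP/(_ ord0 i) := d1.
have := derive_mx d1; rewrite d2 deriveEjacobian// => ->.
by rewrite mxE.
Qed.

End line.

(** * Growth of [U] along a segment *)

Section gradient_flow.
Context {R : realType} {n : nat}.
Variables (U : 'rV[R]_n -> R) (G : R -> R).
Implicit Types (x v p : 'rV[R]_n) (t : R).
Hypothesis U_C2 : twice_continuously_differentiable U.
Hypothesis U_smooth : G_smooth G U.
Hypothesis G_ge0 : forall s : R, 0 <= s -> 0 <= G s.
Hypothesis G_cont : {within `[0, +oo[, continuous G}.
Hypothesis G_ndec : forall s t : R, 0 <= s -> s <= t -> G s <= G t.

Let y (x v : 'rV[R]_n) (t : R) := enorm (gradient U (x + t *: v)).

Let gradient_diff p : differentiable (gradient U) p.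
Proof. by case: U_C2. Qed.

Let hessian_le p v : enorm (v *m hessian U p) <= enorm v * G (enorm (gradient U p)).
Proof.
apply: le_trans (enorm_le_opnorm _ _) _.
by rewrite mulrC ler_wpM2l ?enorm_ge0.
Qed.

Let is_derive_sqr_gradient x v t :
  is_derive t 1 (fun t => \sum_i gradient U (x + t *: v) ord0 i ^+ 2)
    (2 * dotv (gradient U (x + t *: v)) (v *m hessian U (x + t *: v))).
Proof.
rewrite (_ : (fun t => _) =
  \sum_i (fun t => gradient U (x + t *: v) ord0 i) ^+ 2); last first.
  by apply/funext => u; rewrite fct_sumE.
have := @is_derive_sum R _ _ n
  (fun i => (fun t => gradient U (x + t *: v) ord0 i) ^+ 2) t 1 _
  (fun i => is_deriveX 2 (is_derive_gradient i (gradient_diff (x + t *: v)))).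
rewrite (_ : \sum_i _ = 2 * dotv (gradient U (x + t *: v))
  (v *m hessian U (x + t *: v)))//.
by rewrite /dotv mulr_sumr; apply: eq_bigr => i _; rewrite expr1 [LHS]/GRing.scale/= mulrA.
Qed.

Let y_continuous x v : continuous (y x v).
Proof.
move=> t; apply: (continuous_comp (g := @Num.sqrt R)); last exact: sqrt_continuous.
exact: is_derive_continuous (is_derive_sqr_gradient x v t).
Qed.

(** Where the gradient does not vanish, the derivative of its norm is <grad U, v Hess U> / |grad U|
    <= |v Hess U| <= |v| G(|grad U|). *)
Lemma gradient_subsolution x v T : 0 <= T ->
  subsolution G (enorm (gradient U x)) (enorm v) T
    (fun t => enorm (gradient U (x + t *: v))).
Proof.
move=> T0; split => //; first exact: enorm_ge0.
- exact/continuous_subspaceT/y_continuous.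
- by rewrite scale0r addr0.
move=> t _ st; have y0 := le_lt_trans (enorm_ge0 _) st.
have sq0 : 0 < \sum_i gradient U (x + t *: v) ord0 i ^+ 2.
  by rewrite -sqrtr_gt0.
exists ((2 * Num.sqrt (\sum_i gradient U (x + t *: v) ord0 i ^+ 2))^-1 *
   (2 * dotv (gradient U (x + t *: v)) (v *m hessian U (x + t *: v)))).
  exact: (is_derive1_comp (is_derive1_sqrt sq0) (is_derive_sqr_gradient x v t)).
rewrite -/(enorm (gradient U (x + t *: v))).
rewrite invfM mulrACA mulVf ?pnatr_eq0// mul1r mulrC ler_pdivrMr//.
apply: le_trans (dotv_le _ _) _; by rewrite mulrC ler_wpM2r ?enorm_ge0.
Qed.

Lemma gradient_le_flow x v (t r : R) : 0 <= t -> enorm v <= r ->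
  ((enorm (gradient U (x + t *: v)))%:E <= flow G (t * r)%R (enorm (gradient U x)))%E.
Proof.
move=> t0 vr.
apply: (flow_ge_subsolution (enorm_ge0 _) G_cont G_ge0 G_ndec
  (gradient_subsolution x v t0)).
by rewrite mulrC ler_wpM2l.
Qed.

(** Freezing G at G 0 on the negative half-line gives two-sided continuity at 0, so that the
    composition with the norm of the gradient is continuous also where the gradient vanishes. *)
Let continuous_G_nneg : continuous (fun u : R => G (Num.max 0 u)).
Proof.
have /continuous_within_itvcyP[Gin G0] := G_cont.
move=> u; have [u0|u0|u0] := ltgtP u 0.
- rewrite /continuous_at (max_l (ltW u0)).
  refine (cvg_trans (@near_eq_cvg _ _ _ _ (fun=> G 0) (fun w : R => G (Num.max 0 w)) _)
    (cvg_cst (G 0))).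
  have : \forall w \near u, w < 0 by exact: lt_nbhsl.
  by apply: filterS => w w0; rewrite max_l// ltW.
- rewrite /continuous_at (max_r (ltW u0)).
  have Gu : {for u, continuous G} by apply: Gin; rewrite in_itv/= u0.
  refine (cvg_trans (@near_eq_cvg _ _ _ _ G (fun w : R => G (Num.max 0 w)) _) Gu).
  have : \forall w \near u, 0 < w by exact: lt_nbhsr.
  by apply: filterS => w w0; rewrite max_r// ltW.
rewrite u0; apply/left_right_continuousP; rewrite maxxx; split.
- refine (cvg_trans (@near_eq_cvg _ _ _ _ (fun=> G 0) (fun w : R => G (Num.max 0 w)) _)
    (cvg_cst (G 0))).
  have : \forall w \near (0 : R)^'-, w < 0 by exact: nbhs_left_lt.
  by apply: filterS => w w0; rewrite max_l// ltW.
- refine (cvg_trans (@near_eq_cvg _ _ _ _ G (fun w : R => G (Num.max 0 w)) _) G0).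
  have : \forall w \near (0 : R)^'+, 0 < w by exact: nbhs_right_gt.
  by apply: filterS => w w0; rewrite max_r// ltW.
Qed.

Let k x v t := (1 - t) * G (y x v t).

Let k_continuous x v : continuous (k x v).
Proof.
have cGy : continuous (fun t => G (y x v t)).
  rewrite (_ : (fun t => _) = (fun u : R => G (Num.max 0 u)) \o y x v).
    move=> t; apply: continuous_comp; first exact: y_continuous.
    exact: continuous_G_nneg.
  by apply/funext => w /=; rewrite max_r// enorm_ge0.
move=> t; rewrite /continuous_at /k; apply: cvgM; last exact: cGy.
by apply: cvgB; [exact: cvg_cst|exact: cvg_id].
Qed.

(* The function t |-> U (x + t v) + (1 - t) <grad U (x + t v), v> has the
   derivative (1 - t) <v Hess U (x + t v), v>. *)
Lemma taylor_gradient x v :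
  ((U (x + v) - U x - dotv (gradient U x) v)%:E <= (enorm v ^+ 2)%:E *
    \int[lebesgue_measure]_(t in `[0%R, 1%R])
      ((1 - t) * G (enorm (gradient U (x + t *: v))))%:E)%E.
Proof.
have [dU _ _] := U_C2.
(* Starting from -1 makes 0 an interior point, where F has a two-sided derivative. *)
have [F dF] := @antiderivative_gt R (k x v) (-1) (fun u _ => @k_continuous x v u).
have {}dF t : 0 <= t -> is_derive t 1 F (k x v t).
  by move=> t0; apply: dF; rewrite (lt_le_trans _ t0)// ltrN10.
have cF t : 0 <= t -> {for t, continuous F}.
  by move=> /dF /is_derive_continuous.
rewrite (@continuous_FTC2 R (k x v) F 0 1 ltr01); last 3 first.
- exact/continuous_subspaceT/k_continuous.
- split.
  + by move=> t /itvP t01; have [] := dF t; rewrite ?t01.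
  + by apply: cvg_at_right_filter; exact: cF.
  + by apply: cvg_at_left_filter; apply: cF.
- by move=> t /itvP t01; rewrite derive1E; have [|? ->] := dF t; rewrite ?t01.
rewrite -EFinB -EFinM lee_fin.
pose phi t := U (x + t *: v).
pose psi t := dotv (gradient U (x + t *: v)) v.
have dphi t : is_derive t 1 phi (psi t).
  by rewrite /psi -dotv_gradient//; exact: is_derive_line.
pose dpsi t := dotv (v *m hessian U (x + t *: v)) v.
have dpsiP t : is_derive t 1 psi (dpsi t).
  rewrite (_ : psi = \sum_i (fun t => v ord0 i *: gradient U (x + t *: v) ord0 i)); last first.
    by apply/funext => u; rewrite fct_sumE; apply: eq_bigr => i _; rewrite mulrC.
  have := @is_derive_sum R _ _ n
    (fun i t => v ord0 i *: gradient U (x + t *: v) ord0 i) t 1 _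
    (fun i => is_deriveZ (v ord0 i) (is_derive_gradient i (gradient_diff (x + t *: v)))).
  rewrite (_ : \sum_i _ = dpsi t)//.
  by apply: eq_bigr => i _; rewrite mulrC.
have dpsi_le t : dpsi t <= enorm v ^+ 2 * G (y x v t).
  apply: le_trans (dotv_le _ _) _.
  by rewrite mulrC expr2 -mulrA ler_wpM2l ?enorm_ge0// hessian_le.
(* The Taylor function minus |v|^2 F; by the Hessian bound its derivative is nonpositive on [0, 1],
   and D 1 <= D 0 is the claim. *)
pose D t := phi t + (1 - t) * psi t - enorm v ^+ 2 * F t.
pose dD' t := psi t + ((1 - t) * dpsi t - psi t) - enorm v ^+ 2 * k x v t.
have dD t : 0 <= t -> is_derive t 1 D (dD' t).
  move=> t0.
  have d1 : is_derive t 1 (fun t : R => 1 - t) (- 1).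
    by rewrite -[- 1]add0r; apply: is_deriveB.
  have d2 := is_deriveM d1 (dpsiP t).
  have d3 := is_deriveZ (enorm v ^+ 2) (dF t t0).
  have d4 := is_deriveB (is_deriveD (dphi t) d2) d3.
  apply: is_derive_eq d4 _.
  by rewrite /GRing.scale/= mulrN1.
have [||c /itvP c01] := @MVT_segment R D dD' 0 1 ler01.
- by move=> t /itvP t01; apply: dD; rewrite t01.
- by apply: (is_derive_within_continuous (f' := dD')) => t /andP[t0 _]; exact: dD.
rewrite subr0 mulr1 /dD' {1 2}/D subrr mul0r addr0 !subr0 mul1r /phi /psi.
rewrite scale1r scale0r addr0 => e.
suff : (1 - c) * dpsi c <= enorm v ^+ 2 * k x v c by move: e; lra.
rewrite /k mulrCA ler_wpM2l// subr_ge0 c01//.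
Qed.

End gradient_flow.

(** * The curvature constant and the increment of [U] *)

Section curvature.
Context {R : realType}.
Variable (G : R -> R).
Hypothesis G_ge0 : forall s : R, 0 <= s -> 0 <= G s.
Hypothesis G_cont : {within `[0, +oo[, continuous G}.
Hypothesis G_ndec : forall s t : R, 0 <= s -> s <= t -> G s <= G t.

Lemma extend_ge (u : R) (w : \bar R) :
  0 <= u -> (u%:E <= w)%E -> ((G u)%:E <= extend G w)%E.
Proof.
by case: w => [w||]//= u0; rewrite ?leey// !lee_fin; exact: G_ndec.
Qed.

Lemma averaged_profile_ge0 r s : 0 <= r -> 0 <= s -> (0 <= averaged_profile G r s)%E.
Proof.
move=> r0 s0; rewrite mule_ge0// integral_ge0// => t /=; rewrite in_itv/= => /andP[t0 t1].
rewrite mule_ge0 ?lee_fin ?subr_ge0//.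
apply: (@le_trans _ _ (G s)%:E); first by rewrite lee_fin G_ge0.
apply: extend_ge => //.
(* The constant path s is a subsolution of speed 0, so the flow stays above s. *)
apply: (flow_ge_subsolution s0 G_cont G_ge0 G_ndec (rho := 0) (T := 0) (y := fun=> s)).
  split => //; first by move=> ?; exact: cvg_cst.
  by move=> t' _; rewrite ltxx.
by rewrite mul0r mulr_ge0.
Qed.

Lemma curvature_constant_ge r sigma s : 0 <= s ->
  ((r ^+ 2 / 2)%:E * (averaged_profile G r s * (1 + sigma * s)^-1%:E) <=
   curvature_constant r sigma G)%E.
Proof.
move=> s0; rewrite lee_wpmul2l// ?lee_fin ?divr_ge0 ?sqr_ge0//.
by apply: ereal_sup_ubound; exists s.
Qed.

Lemma curvature_constant_ge0 r sigma : 0 <= r -> (0 <= curvature_constant r sigma G)%E.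
Proof.
move=> r0; apply: le_trans (curvature_constant_ge r sigma (lexx 0)).
rewrite mule_ge0 ?lee_fin ?divr_ge0 ?sqr_ge0// mule_ge0 ?averaged_profile_ge0//.
by rewrite lee_fin mulr0 addr0 invr1.
Qed.

Lemma increment_le n (U : 'rV[R]_n -> R) (r sigma K : R) (x v : 'rV[R]_n) :
  twice_continuously_differentiable U -> G_smooth G U ->
  0 < r -> 0 < sigma -> curvature_constant r sigma G = K%:E -> enorm v <= r ->
  U (x + v) - U x <= dotv (gradient U x) v +
    (enorm v / r) ^+ 2 * (K * (1 + sigma * enorm (gradient U x))).
Proof.
move=> UC2 Usmooth r0 sigma0 KE vr; set s := enorm (gradient U x).
have s0 : 0 <= s by exact: enorm_ge0.
have s1 : 0 < 1 + sigma * s by rewrite ltr_wpDr// mulr_ge0// ltW.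
have := taylor_gradient UC2 Usmooth G_cont x v.
set I := (\int[_]_(t in _) _)%E => UI.
have I0 : (0 <= I)%E.
  apply: integral_ge0 => t /=; rewrite in_itv/= => /andP[t0 t1].
  by rewrite lee_fin mulr_ge0 ?subr_ge0// G_ge0// enorm_ge0.
have II : (2%:E * I <= averaged_profile G r s)%E.
  rewrite lee_wpmul2l ?lee_fin//; apply: ge0_le_integral_nomeas.
    move=> t /=; rewrite in_itv/= => /andP[t0 t1].
    by rewrite lee_fin mulr_ge0 ?subr_ge0// G_ge0// enorm_ge0.
  move=> t /=; rewrite in_itv/= => /andP[t0 t1]; rewrite EFinM.
  rewrite lee_wpmul2l ?lee_fin ?subr_ge0//; apply: extend_ge; first exact: enorm_ge0.
  exact: (gradient_le_flow UC2 Usmooth G_ge0 G_cont G_ndec x t0 vr).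
have := curvature_constant_ge r sigma s0; rewrite KE => Kge.
have r20 : 0 < r ^+ 2 by rewrite exprn_gt0.
have IK : ((r ^+ 2 / 2)%:E * (2%:E * I * (1 + sigma * s)^-1%:E) <= K%:E)%E.
  apply: le_trans Kge; apply: lee_wpmul2l; first by rewrite lee_fin divr_ge0// ltW.
  by apply: lee_wpmul2r => //; rewrite lee_fin invr_ge0 ltW.
(* An infinite integral would force the finite number K to be infinite. *)
case: I UI I0 {II} IK => [I||] // UI I0 IK; last first.
  move: IK; rewrite gt0_muley// gt0_mulye ?lte_fin ?invr_gt0// gt0_muley//.
  by rewrite lte_fin divr_gt0.
move: UI I0 IK; rewrite -!EFinM !lee_fin => UI I0 IK.
rewrite -lerBlDl; apply: le_trans UI _.
have rn0 : r != 0 by rewrite gt_eqF.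
rewrite [leRHS](_ : _ = enorm v ^+ 2 * (K * (1 + sigma * s) / r ^+ 2)); last by field.
apply: ler_wpM2l; first exact: sqr_ge0.
have {}IK : r ^+ 2 * I / (1 + sigma * s) <= K.
  by apply: le_trans IK; rewrite le_eqVlt; apply/orP; left; apply/eqP; field; rewrite gt_eqF.
by rewrite ler_pdivlMr// mulrC -ler_pdivrMr.
Qed.

End curvature.

(** * The acceptance probability *)

Section acceptance_bound.
Local Open Scope ereal_scope.
Context {R : realType}.
Local Notation N01 := (@normal_prob R 0 1).
Local Notation M := (measurableTypeR R).

Lemma PhiB (a b : R) : (a <= b)%R -> Phi b - Phi a = N01 `]a, b].
Proof.
move=> ab; rewrite /Phi.
have -> : `]-oo, b]%classic = `]-oo, a]%classic `|` `]a, b]%classic.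
  by rewrite -itv_bndbnd_setU.
rewrite measureU//.
  by rewrite addeAC subee ?add0e// fin_num_measure.
apply/seteqP; split => // x /=; rewrite !in_itv/= => -[xa /andP[ax _]].
by move: (lt_le_trans ax xa); rewrite ltxx.
Qed.

(** The convention for zero degrees of freedom fits the formula: the law is the point mass at the
    empty tuple, whose sum is 0 <= c * 0. *)
Lemma chi2_probE (n : nat) (c : R) :
  chi2_prob n c = @gaussian_tuple R n (@sqsum R n @^-1` `]-oo, (c * n%:R)%R]).
Proof.
have E : [set z : n.-tuple M | (\sum_(i < n) tnth z i ^+ 2 <= c * n%:R)%R] =
    @sqsum R n @^-1` `]-oo, (c * n%:R)%R].
  by apply/seteqP; split => z /=; rewrite in_itv.
case: n E => [|n] E; last by rewrite /= /chi2_cdf E.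
rewrite -E /= diracE mem_set//=.
by rewrite big_ord0 mulr0.
Qed.

Lemma integral_box (n : nat) (a b q m : R) : (0 <= m)%R ->
  \int[N01]_w \int[@gaussian_tuple R n]_z
    (m * \1_(`]a, b] `*` `]-oo, q]) (w : M, sqsum z))%:E =
  m%:E * @gaussian_tuple R n (@sqsum R n @^-1` `]-oo, q]) * N01 `]a, b].
Proof.
move=> m0.
have mJ : measurable (@sqsum R n @^-1` `]-oo, q]).
  by rewrite -[X in measurable X]setTI; exact: measurable_sqsum.
transitivity (\int[N01]_w
    (m%:E * @gaussian_tuple R n (@sqsum R n @^-1` `]-oo, q]) * (\1_`]a, b] w)%:E)).
  apply: eq_integral => w _.
  transitivity (\int[@gaussian_tuple R n]_z
     ((m * \1_`]a, b] w)%:E * (\1_(@sqsum R n @^-1` `]-oo, q]) z)%:E)).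
    apply: eq_integral => z _; rewrite -EFinM -mulrA; congr (_ * _)%:E.
    rewrite !indicE.
    have -> : ((w, sqsum z) \in `]a, b] `*` `]-oo, q]) =
        (w \in `]a, b]%classic) && (z \in @sqsum R n @^-1` `]-oo, q]).
      by apply/idP/andP; rewrite !inE => -[].
    by case: (w \in _); case: (z \in _); rewrite ?mulr1 ?mulr0 ?mul0r.
  rewrite ge0_integralZl//; last 2 first.
  - exact/measurable_EFinP.
  - by rewrite lee_fin mulr_ge0.
  by rewrite integral_indic// setIT EFinM muleAC.
rewrite ge0_integralZl//; last 2 first.
- exact/measurable_EFinP.
- by rewrite mule_ge0.
by rewrite integral_indic// setIT.
Qed.

End acceptance_bound.

Unset Implicit Arguments.

Theorem proposition8 (R : realType) (d : nat) (U : 'rV[R]_d -> R) (G : R -> R)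
    (sigma c : R) (K : \bar R)
    (d_ge1 : (1 <= d)%N)
    (U_C2 : twice_continuously_differentiable U)
    (U_int : (\int[lebesgue_tuple d]_z (expR (- U (row_of_tuple z)))%:E
              < +oo)%E)
    (G_ge0 : forall s : R, 0 <= s -> 0 <= G s)
    (G_cont : {within `[0, +oo[, continuous G})
    (G_ndec : forall s t : R, 0 <= s -> s <= t -> G s <= G t)
    (U_smooth : G_smooth G U)
    (sigma_gt0 : 0 < sigma)
    (c_gt1 : 1 < c)
    (K_def : K = curvature_constant (sigma * Num.sqrt (c * d%:R)) sigma G)
    (K_lt : (K < (Num.sqrt c)%:E)%E) :
  (min_acceptance U sigma >=
     (expR (- fine K))%:E * chi2_prob d.-1 c *
       (Phi (Num.sqrt c) - Phi (fine K)))%E.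
Proof.
case: d => [//|n] in U d_ge1 U_C2 U_int U_smooth K_def *.
have c0 : 0 < c by exact: lt_trans c_gt1.
set r := sigma * _ in K_def.
have r0 : 0 < r by rewrite mulr_gt0// sqrtr_gt0 mulr_gt0.
have r2 : r ^+ 2 = sigma ^+ 2 * (c * n.+1%:R).
  by rewrite exprMn sqr_sqrtr// mulr_ge0 ?ltW.
have K0 : (0 <= K)%E by rewrite K_def curvature_constant_ge0// ltW.
have [k KE] : exists k, K = k%:E.
  by move: K0 K_lt; case: (K) => [k||]//; exists k.
move: K0 K_lt K_def; rewrite KE lee_fin lte_fin /= => k0 kc /esym kE.
rewrite PhiB ?chi2_probE; last exact: ltW.
apply: le_ereal_inf_tmp => _ [x _ <-].
(* At a critical point x this gives s = 0 and some unit vector [u]. *)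
have [u u1 gu] := unit_direction (fun i => gradient U x ord0 i).
set s := Num.sqrt _ in gu.
have sE : enorm (gradient U x) = s by [].
have s0 : 0 <= s by exact: sqrtr_ge0.
pose e i := - u i.
have e1 : \sum_i e i ^+ 2 = 1 by rewrite -u1; apply: eq_bigr => i _; rewrite sqrrN.
pose B : set (measurableTypeR R * measurableTypeR R) :=
  `]k, Num.sqrt c]%classic `*` `]-oo, c * n%:R]%classic.
pose f (p : measurableTypeR R * measurableTypeR R) := (expR (- k) * \1_B p)%:E.
have mf : measurable_fun setT f.
  apply/measurable_EFinP; apply: measurable_funM => //.
  by apply: measurable_indic; exact: measurableX.
have f0 p : (0 <= f p)%E by rewrite lee_fin mulr_ge0 ?expR_ge0.
rewrite -(integral_box n k (Num.sqrt c) (c * n%:R) (expR_ge0 (- k))).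
apply: le_trans (_ : \int[@gaussian_tuple R n.+1]_z
  f (dotp e z, (sqsum z - dotp e z ^+ 2)%R) <= _)%E.
  by rewrite (integral_rotation e1 mf f0).
apply: ge0_le_integral_nomeas => // z _; rewrite /f.
(* Off the event the lower bound is 0. On it the increment of U has to be at most k; since k >= 0,
   this also bounds its positive part. *)
have [|] := boolP ((dotp e z, (sqsum z - dotp e z ^+ 2)) \in B); last first.
  by move=> zB; rewrite indicE (negbTE zB) mulr0 lee_fin expR_ge0.
rewrite indicE => zB; rewrite zB mulr1 lee_fin ler_expR lerN2 ge_max k0 andbT.
move: zB; rewrite inE => -[/=]; rewrite !in_itv/= => /andP[kw wc] qc.
set w := dotp e z in kw wc qc.
have dE : dotv (gradient U x) (sigma *: row_of_tuple z) = - (sigma * s * w).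
  rewrite /dotv /w /dotp mulr_sumr -sumrN; apply: eq_bigr => i _.
  by rewrite gu !mxE /e; ring.
have vE : enorm (sigma *: row_of_tuple z) ^+ 2 = sigma ^+ 2 * sqsum z.
  rewrite enormZ exprMn sqr_enorm real_normK ?num_real//; congr (_ * _).
  by apply: eq_bigr => i _; rewrite mxE.
(* Here w > k >= 0, so the one-sided bound w <= sqrt c can be squared. *)
have w2 : w ^+ 2 <= c.
  rewrite -[leRHS](sqr_sqrtr (ltW c0)) ler_sqr ?nnegrE ?sqrtr_ge0//.
  by rewrite (le_trans k0)// ltW.
have zc : sqsum z <= c * n.+1%:R by rewrite -natr1 mulrDr mulr1; lra.
have vr2 : enorm (sigma *: row_of_tuple z) ^+ 2 <= r ^+ 2.
  by rewrite vE r2 ler_wpM2l ?sqr_ge0.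
have vr : enorm (sigma *: row_of_tuple z) <= r.
  by move: vr2; rewrite ler_sqr// nnegrE ?enorm_ge0 ?ltW.
have := increment_le G_ge0 G_cont G_ndec x U_C2 U_smooth r0 sigma_gt0 kE vr.
rewrite dE sE => Uz; apply: le_trans Uz _.
have q1 : (enorm (sigma *: row_of_tuple z) / r) ^+ 2 <= 1.
  by rewrite expr_div_n ler_pdivrMr ?exprn_gt0// mul1r.
have ks : 0 <= k * (1 + sigma * s).
  by rewrite mulr_ge0// addr_ge0// mulr_ge0// ltW.
apply: (@le_trans _ _ (- (sigma * s * w) + k * (1 + sigma * s))).
  by rewrite lerD2l ler_piMl.
have : sigma * s * k <= sigma * s * w.
  by rewrite ler_wpM2l ?mulr_ge0 ?(ltW sigma_gt0)// ltW.
lra.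
Qed.
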